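(* Let $R$ be an associative ring with identity. The following properties hold: (1) $R$ is right coherent if and only if the flat-precover completing domain $\mathfrak{F}^{-1}(M)$ of any left $R$-module $M$ is closed under arbitrary direct products. (2) $\mathrm{wdim}(R)\leq 1$ if and only if the flat-precover completing domain $\mathfrak{F}^{-1}(M)$ of any left $R$-module $M$ is closed under submodules. (3) $R$ is left semihereditary if and only if the flat-precover completing domain of any right $R$-module is closed under arbitrary direct products and the flat-precover completing domain of any left $R$-module is closed under submodules.
   Context: Modules are unital. $\mathrm{wdim}(R)$ denotes the weak global dimension of $R$. A flat precover of a module $N$ is a morphism $g:F\to N$ with $F$ flat such that $\mathrm{Hom}(F',F)\to\mathrm{Hom}(F',N)$ is surjective for every flat module $F'$. The flat-precover completing domain $\mathfrak{F}^{-1}(M)$ of a left $R$-module $M$ is the class of all left $R$-modules $N$ such that for every morphism $f:M\to N$ and every flat precover $g:F\to N$ there is a morphism $h:M\to F$ with $gh=f$; for a right $R$-module it is defined in the same way in the category of right $R$-modules. *)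

(* Defs.v *)
From HB Require Import structures.
From mathcomp Require Import all_boot all_algebra generic_quotient.
From mathcomp Require Import boolp.

Set Implicit Arguments.
Unset Strict Implicit.
Unset Printing Implicit Defensive.

Import GRing.Theory.
Local Open Scope ring_scope.
Local Open Scope quotient_scope.

(* Left R-modules are [lmodType R]; right R-modules are [lmodType R^c], where  *)
(* [r *: a] stands for the right action [a r]. Rings are [pzRingType], i.e.    *)
(* associative unital, with the zero ring allowed.                             *)

Definition surjective (S T : Type) (f : S -> T) : Prop :=
  forall y, exists x, f x = y.

Definition exact_at (S : pzRingType) (A B C : lmodType S)
    (f : {linear A -> B}) (g : {linear B -> C}) : Prop :=
  forall y : B, g y = 0 <-> exists x : A, f x = y.

Section DirectProduct.
Variables (S : pzRingType) (I : Type) (N : I -> lmodType S).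

Definition dirprod : Type := forall i : I, N i.

Implicit Types u v w : dirprod.

Definition dirprod0 : dirprod := fun=> 0.
Definition dirprod_add u v : dirprod := fun i => u i + v i.
Definition dirprod_opp u : dirprod := fun i => - u i.
Definition dirprod_scale (r : S) u : dirprod := fun i => r *: u i.

HB.instance Definition _ := gen_eqMixin dirprod.
HB.instance Definition _ := gen_choiceMixin dirprod.

Fact dirprod_addA : associative dirprod_add.
Proof. by move=> u v w; apply: functional_extensionality_dep => i; apply: addrA. Qed.
Fact dirprod_addC : commutative dirprod_add.
Proof. by move=> u v; apply: functional_extensionality_dep => i; apply: addrC. Qed.
Fact dirprod_add0 : left_id dirprod0 dirprod_add.
Proof. by move=> u; apply: functional_extensionality_dep => i; apply: add0r. Qed.
Fact dirprod_addN : left_inverse dirprod0 dirprod_opp dirprod_add.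
Proof. by move=> u; apply: functional_extensionality_dep => i; apply: addNr. Qed.

HB.instance Definition _ := GRing.isZmodule.Build dirprod
  dirprod_addA dirprod_addC dirprod_add0 dirprod_addN.

Fact dirprod_scaleA r s u :
  dirprod_scale r (dirprod_scale s u) = dirprod_scale (r * s) u.
Proof. by apply: functional_extensionality_dep => i; apply: scalerA. Qed.
Fact dirprod_scale1 : left_id 1 dirprod_scale.
Proof. by move=> u; apply: functional_extensionality_dep => i; apply: scale1r. Qed.
Fact dirprod_scaleDr : right_distributive dirprod_scale +%R.
Proof. by move=> r u v; apply: functional_extensionality_dep => i; apply: scalerDr. Qed.
Fact dirprod_scaleDl u :
  {morph dirprod_scale^~ u : r s / r + s}.
Proof. by move=> r s; apply: functional_extensionality_dep => i; apply: scalerDl. Qed.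

HB.instance Definition _ := GRing.Zmodule_isLmodule.Build S dirprod
  dirprod_scaleA dirprod_scale1 dirprod_scaleDr dirprod_scaleDl.

End DirectProduct.

Definition closed_under_products (S : pzRingType) (C : lmodType S -> Prop) :=
  forall (I : Type) (N : I -> lmodType S), (forall i, C (N i)) -> C (dirprod N).

(* A submodule is given, up to isomorphism, by its inclusion. *)
Definition closed_under_submodules (S : pzRingType) (C : lmodType S -> Prop) :=
  forall (N K : lmodType S) (i : {linear K -> N}), injective i -> C N -> C K.

Section Tensor.
Variables (R : pzRingType) (A : lmodType R^c) (M : lmodType R).

Definition balanced (T : zmodType) (b : A -> M -> T) : Prop :=
  [/\ forall a a' m, b (a + a') m = b a m + b a' m,
      forall a m m', b a (m + m') = b a m + b a m'
    & forall a (r : R) m, b ((r : R^c) *: a) m = b a (r *: m)].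

Definition is_tensor (T : zmodType) (b : A -> M -> T) : Prop :=
  balanced b /\
  forall (U : zmodType) (c : A -> M -> U), balanced c ->
    exists g : {additive T -> U},
      (forall a m, g (b a m) = c a m) /\
      forall h : {additive T -> U}, (forall a m, h (b a m) = c a m) -> h =1 g.

End Tensor.

(* The functor - (x)_R M preserves monomorphisms; tensor products exist        *)
(* ([tensor_exists] below) and are unique up to isomorphism, so it does not    *)
(* matter which ones are taken.                                                *)
Definition left_flat (R : pzRingType) (M : lmodType R) : Prop :=
  forall (A B : lmodType R^c) (f : {linear A -> B}), injective f ->
  forall (T U : zmodType) (b : A -> M -> T) (c : B -> M -> U),
    is_tensor b -> is_tensor c ->
  forall g : {additive T -> U}, (forall a m, g (b a m) = c (f a) m) ->
    injective g.

Definition right_flat (R : pzRingType) (A : lmodType R^c) : Prop :=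
  forall (M N : lmodType R) (f : {linear M -> N}), injective f ->
  forall (T U : zmodType) (b : A -> M -> T) (c : A -> N -> U),
    is_tensor b -> is_tensor c ->
  forall g : {additive T -> U}, (forall a m, g (b a m) = c a (f m)) ->
    injective g.

Definition precover (S : pzRingType) (flat : lmodType S -> Prop)
    (F N : lmodType S) (g : {linear F -> N}) : Prop :=
  flat F /\
  forall F' : lmodType S, flat F' -> forall f : {linear F' -> N},
    exists h : {linear F' -> F}, forall x, g (h x) = f x.

Definition precover_completing_domain (S : pzRingType)
    (flat : lmodType S -> Prop) (M N : lmodType S) : Prop :=
  forall (f : {linear M -> N}) (F : lmodType S) (g : {linear F -> N}),
    precover flat g -> exists h : {linear M -> F}, forall x, g (h x) = f x.

Definition left_flat_domain (R : pzRingType) (M : lmodType R) :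
    lmodType R -> Prop :=
  precover_completing_domain (@left_flat R) M.

Definition right_flat_domain (R : pzRingType) (M : lmodType R^c) :
    lmodType R^c -> Prop :=
  precover_completing_domain (@right_flat R) M.

Section Finiteness.
Variables (S : pzRingType) (M : lmodType S).

Definition finitely_generated : Prop :=
  exists (n : nat) (x : 'I_n -> M),
    forall y, exists c : 'I_n -> S, y = \sum_i c i *: x i.

Definition finitely_presented : Prop :=
  exists (m n : nat) (f : {linear 'rV[S]_m -> 'rV[S]_n})
         (g : {linear 'rV[S]_n -> M}),
    surjective g /\ exact_at f g.

Definition projective : Prop :=
  forall (A B : lmodType S) (p : {linear A -> B}), surjective p ->
  forall f : {linear M -> B},
    exists h : {linear M -> A}, forall x, p (h x) = f x.

End Finiteness.

(* One-sided ideals are submodules of the regular module, again given by their *)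
(* inclusions; [R^c^o] is R as a right module over itself.                     *)
Definition right_coherent (R : pzRingType) : Prop :=
  forall (J : lmodType R^c) (i : {linear J -> R^c^o}), injective i ->
    finitely_generated J -> finitely_presented J.

Definition left_semihereditary (R : pzRingType) : Prop :=
  forall (J : lmodType R) (i : {linear J -> R^o}), injective i ->
    finitely_generated J -> projective J.

(* fd(M) <= n: there is an exact sequence 0 -> F_n -> ... -> F_0 -> M -> 0     *)
(* with all F_i flat, extended by zero modules beyond n.                       *)
Definition flat_dim_le (R : pzRingType) (M : lmodType R) (n : nat) : Prop :=
  exists (F : nat -> lmodType R) (d : forall i, {linear F i.+1 -> F i})
         (e : {linear F 0%N -> M}),
    [/\ forall i, left_flat (F i),
        forall i, (n < i)%N -> forall x : F i, x = 0,
        surjective e,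
        exact_at (d 0%N) e
      & forall i, exact_at (d i.+1) (d i)].

(* The weak global dimension is the supremum of the flat dimensions of the     *)
(* left modules.                                                               *)
Definition wdim_le (R : pzRingType) (n : nat) : Prop :=
  forall M : lmodType R, flat_dim_le M n.

(* Existence of tensor products: formal sums of pairs, identified when every   *)
(* balanced map sends them to the same element.                                *)
Section TensorExists.
Variables (R : pzRingType) (A : lmodType R^c) (M : lmodType R).

Let ev (T : zmodType) (b : A -> M -> T) (s : seq (A * M)) : T :=
  \sum_(p <- s) b p.1 p.2.

Let sim (s t : seq (A * M)) : bool :=
  `[< forall (T : zmodType) (b : A -> M -> T), balanced b -> ev b s = ev b t >].

Let sim_refl : reflexive sim.
Proof. by move=> s; apply/asboolP. Qed.
Let sim_sym : symmetric sim.
Proof.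
by move=> s t; apply/asboolP/asboolP => h T b hb; rewrite (h T b hb).
Qed.
Let sim_trans : transitive sim.
Proof.
move=> s t u /asboolP h /asboolP k; apply/asboolP => T b hb.
by rewrite (h T b hb) (k T b hb).
Qed.

Let simE := EquivRel sim sim_refl sim_sym sim_trans.

Definition tens : Type := {eq_quot simE}.
HB.instance Definition _ := Choice.on tens.

Let tens_of (s : seq (A * M)) : tens := \pi_({eq_quot simE}) s.
Let rep (x : tens) : seq (A * M) := repr (x : {eq_quot simE}).

Let tens_ofK x : tens_of (rep x) = x.
Proof. exact: reprK. Qed.

Let ev_rep (T : zmodType) (b : A -> M -> T) s :
  balanced b -> ev b (rep (tens_of s)) = ev b s.
Proof.
move=> hb; have /asboolP : sim (rep (tens_of s)) s.
  by apply/(eqmodP simE); rewrite reprK.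
by apply.
Qed.

Let tens_eq x y :
  (forall (T : zmodType) (b : A -> M -> T), balanced b -> ev b (rep x) = ev b (rep y)) ->
  x = y.
Proof.
move=> h; rewrite -[x]tens_ofK -[y]tens_ofK.
by apply/(eqmodP simE)/asboolP => T b hb; apply: h.
Qed.

Let ev_cat (T : zmodType) (b : A -> M -> T) s t : ev b (s ++ t) = ev b s + ev b t.
Proof. by rewrite /ev big_cat. Qed.

Let balanced_opp (T : zmodType) (b : A -> M -> T) a m :
  balanced b -> b (- a) m = - b a m.
Proof.
case=> bD _ _; have b0 : b 0 m = 0.
  by apply: (addrI (b 0 m)); rewrite -bD !addr0.
by apply: (addrI (b a m)); rewrite -bD !subrr.
Qed.

Let ev_opp (T : zmodType) (b : A -> M -> T) s : balanced b ->
  ev b [seq (- p.1, p.2) | p <- s] = - ev b s.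
Proof.
move=> hb; rewrite /ev big_map -sumrN; apply: eq_bigr => p _ /=.
exact: balanced_opp.
Qed.

Let tadd (x y : tens) : tens := tens_of (rep x ++ rep y).
Let topp (x : tens) : tens := tens_of [seq (- p.1, p.2) | p <- rep x].
Let tzero : tens := tens_of [::].

Let ev_add (T : zmodType) (b : A -> M -> T) x y : balanced b ->
  ev b (rep (tadd x y)) = ev b (rep x) + ev b (rep y).
Proof. by move=> hb; rewrite ev_rep // ev_cat. Qed.

Let ev_zero (T : zmodType) (b : A -> M -> T) : balanced b -> ev b (rep tzero) = 0.
Proof. by move=> hb; rewrite ev_rep // /ev big_nil. Qed.

Let ev_topp (T : zmodType) (b : A -> M -> T) x : balanced b ->
  ev b (rep (topp x)) = - ev b (rep x).
Proof. by move=> hb; rewrite ev_rep // ev_opp. Qed.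

Let taddA : associative tadd.
Proof. by move=> x y z; apply: tens_eq => T b hb; rewrite !ev_add // addrA. Qed.
Let taddC : commutative tadd.
Proof. by move=> x y; apply: tens_eq => T b hb; rewrite !ev_add // addrC. Qed.
Let tadd0 : left_id tzero tadd.
Proof.
by move=> x; apply: tens_eq => T b hb; rewrite ev_add // ev_zero // add0r.
Qed.
Let taddN : left_inverse tzero topp tadd.
Proof.
move=> x; apply: tens_eq => T b hb.
by rewrite ev_add // ev_topp // ev_zero // addNr.
Qed.

HB.instance Definition _ :=
  GRing.isZmodule.Build tens taddA taddC tadd0 taddN.

Lemma tensor_exists :
  exists (T : zmodType) (b : A -> M -> T), is_tensor b.
Proof.
pose b a m := tens_of [:: (a, m)].
have evb (T : zmodType) (c : A -> M -> T) a m : balanced c -> ev c (rep (b a m)) = c a m.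
  by move=> hc; rewrite ev_rep // /ev big_seq1.
exists tens, b; split.
  split=> [a a' m|a m m'|a r m]; apply: tens_eq => T c hc;
    rewrite ?ev_add // !evb //; by case: hc => h1 h2 h3.
move=> U c hc; pose g (x : tens) := ev c (rep x).
have gB : zmod_morphism g.
  by move=> x y; rewrite /g ev_add // ev_topp.
pose gM := GRing.isZmodMorphism.Build tens U g gB.
pose G : {additive tens -> U} := HB.pack g gM.
exists G; split=> [a m|h hb x]; first exact: evb.
rewrite -[x]tens_ofK; elim: (rep x) => [|[a m] s IHs].
  have -> : tens_of [::] = 0 by [].
  by rewrite !raddf0.
have -> : tens_of ((a, m) :: s) = b a m + tens_of s.
  by apply: tens_eq => T d hd; rewrite ev_add // !ev_rep // -ev_cat.
by rewrite !raddfD IHs hb /=; congr (_ + _); rewrite /g evb.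
Qed.

End TensorExists.

(* Main.v *)
Require Import Defs.
From HB Require Import structures.
From mathcomp Require Import all_boot all_algebra.
From mathcomp Require Import boolp classical_sets.

Set Implicit Arguments.
Unset Strict Implicit.
Unset Printing Implicit Defensive.

Import GRing.Theory.
Local Open Scope ring_scope.

(* Flatness is used through the equational criterion: a relation               *)
(* [\sum_i r i *: x i = 0] holds because of relations between coefficients.     *)
(* With it, products of flat modules are flat iff the relations between          *)
(* finitely many ring elements are finitely generated (Chase), and submodules    *)
(* of flat modules are flat iff [c *m r = 0] always has a matrix [E] with        *)
(* [E *m r = r] and [c *m E = 0], a condition that is left-right symmetric; an   *)
(* [E] that works for all [c] at once splits the ideal generated by the entries  *)
(* of [r].                                                                       *)
(*                                                                               *)
(* The completing domains only see these properties once flat precovers exist.   *)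
(* As in Bican, El Bashir and Enochs, a map from a flat module [F] to [N] is     *)
(* factored through the quotient of [F] by a maximal submodule of the kernel     *)
(* with flat quotient, and this quotient is shown to be small: it is the image   *)
(* of a W-type that depends only on the ring and on [N]. The direct sum of all   *)
(* flat modules that small, over all their maps to [N], is then a precover.      *)

(** * Modules presented by setoids *)

(** A flat module lies in every completing domain, because its flat precovers split
    ([eqflat_completing]). Conversely, a module in its own completing domain is a retract of a flat
    precover, hence flat ([completing_eqflat], by way of [flat_precover_exists]). So closure of all
    domains under products or submodules forces the same closure on flat modules. That closure also
    suffices: lifts into a power of the precover, or into a submodule of an auxiliary precover, can
    be pushed on through the given one ([flat_productsP], [flat_submodulesP]).

    What remains concerns flat modules only. Products of flat left modules are flat iff the ring is
    right coherent ([flat_products_relations_fg], [right_coherentP]). If the weak dimension is at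
    most 1, a length-one flat resolution of [F/K] shows that [K] is the kernel of a surjection
    between flat modules ([pullback_eqflat]); conversely, the kernel of a flat precover completes
    such a resolution ([wdim_le1P]). Finally, all finitely generated left ideals are projective iff
    the ring is left coherent and submodules of flat left modules are flat ([left_semihereditaryP]);
    left coherence is closure of flat right modules under products. *)

Record zsetoid (X : Type) := ZSetoid {
  zeq : X -> X -> Prop;
  zzero : X;
  zadd : X -> X -> X;
  zopp : X -> X;
  zeq_refl : forall x, zeq x x;
  zeq_sym : forall x y, zeq x y -> zeq y x;
  zeq_trans : forall x y z, zeq x y -> zeq y z -> zeq x z;
  zeq_add : forall x x' y y',
    zeq x x' -> zeq y y' -> zeq (zadd x y) (zadd x' y');
  zeq_opp : forall x x', zeq x x' -> zeq (zopp x) (zopp x');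
  zeq_addA : forall x y z, zeq (zadd x (zadd y z)) (zadd (zadd x y) z);
  zeq_addC : forall x y, zeq (zadd x y) (zadd y x);
  zeq_add0 : forall x, zeq (zadd zzero x) x;
  zeq_addN : forall x, zeq (zadd (zopp x) x) zzero }.

Section ZQuotient.
Variables (X : Type) (s : zsetoid X).

Definition zquot : Type := {A : X -> Prop | exists x, A = zeq s x}.

Definition zclass (x : X) : zquot :=
  exist _ (zeq s x) (ex_intro _ x (erefl (zeq s x))).

Definition zrep (q : zquot) : X := projT1 (cid (proj2_sig q)).

Lemma zrepK q : zclass (zrep q) = q.
Proof.
case: q => A hA; rewrite /zrep /=; case: cid => x /= Ax.
exact: eq_exist.
Qed.

Lemma zclass_eq x y : zclass x = zclass y <-> zeq s x y.
Proof.
split=> [[->]|xy]; first exact: zeq_refl.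
apply: eq_exist; apply/funext => z; apply/propext.
by split=> [xz|yz]; [apply: zeq_trans xz; apply: zeq_sym | apply: zeq_trans yz].
Qed.

Lemma zeq_rep x : zeq s (zrep (zclass x)) x.
Proof. by apply/zclass_eq; rewrite zrepK. Qed.

Definition zq_add (p q : zquot) := zclass (zadd s (zrep p) (zrep q)).
Definition zq_opp (p : zquot) := zclass (zopp s (zrep p)).

Lemma zq_addE x y : zq_add (zclass x) (zclass y) = zclass (zadd s x y).
Proof. by apply/zclass_eq/zeq_add; apply: zeq_rep. Qed.

Lemma zq_oppE x : zq_opp (zclass x) = zclass (zopp s x).
Proof. exact/zclass_eq/zeq_opp/zeq_rep. Qed.

HB.instance Definition _ := gen_eqMixin zquot.
HB.instance Definition _ := gen_choiceMixin zquot.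

Fact zq_addA : associative zq_add.
Proof.
move=> p q r; rewrite -(zrepK p) -(zrepK q) -(zrepK r) !zq_addE.
exact/zclass_eq/zeq_addA.
Qed.
Fact zq_addC : commutative zq_add.
Proof. move=> p q; exact/zclass_eq/zeq_addC. Qed.
Fact zq_add0 : left_id (zclass (zzero s)) zq_add.
Proof. by move=> p; rewrite -(zrepK p) zq_addE; apply/zclass_eq/zeq_add0. Qed.
Fact zq_addN : left_inverse (zclass (zzero s)) zq_opp zq_add.
Proof.
by move=> p; rewrite -(zrepK p) zq_oppE zq_addE; apply/zclass_eq/zeq_addN.
Qed.

HB.instance Definition _ :=
  GRing.isZmodule.Build zquot zq_addA zq_addC zq_add0 zq_addN.

Lemma zclassD x y : zclass (zadd s x y) = zclass x + zclass y.
Proof. by rewrite -zq_addE. Qed.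

Lemma zclass0 : zclass (zzero s) = 0.
Proof. by []. Qed.

End ZQuotient.

(** For a fixed carrier [X] these records form one type, built from [S] and [X] alone. This is what
    later allows a direct sum over all module structures on quotients of [X]. *)
Record msetoid (S : pzRingType) (X : Type) := MSetoid {
  mzs :> zsetoid X;
  mscale : S -> X -> X;
  zeq_scale : forall r x y, zeq mzs x y -> zeq mzs (mscale r x) (mscale r y);
  zeq_scaleA : forall r t x,
    zeq mzs (mscale r (mscale t x)) (mscale (r * t) x);
  zeq_scale1 : forall x, zeq mzs (mscale 1 x) x;
  zeq_scaleDr : forall r x y, zeq mzs (mscale r (zadd mzs x y))
    (zadd mzs (mscale r x) (mscale r y));
  zeq_scaleDl : forall x r t, zeq mzs (mscale (r + t) x)
    (zadd mzs (mscale r x) (mscale t x)) }.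

Section MQuotient.
Variables (S : pzRingType) (X : Type) (s : msetoid S X).

Definition mquot : Type := zquot s.

HB.instance Definition _ := GRing.Zmodule.on mquot.

Definition mclass (x : X) : mquot := zclass s x.

Definition mq_scale (r : S) (q : mquot) : mquot := mclass (mscale s r (zrep q)).

Lemma mq_scaleE r x : mq_scale r (mclass x) = mclass (mscale s r x).
Proof. exact/zclass_eq/zeq_scale/zeq_rep. Qed.

Lemma mclass_eq x y : mclass x = mclass y <-> zeq s x y.
Proof. exact: zclass_eq. Qed.

Lemma mclassD x y : mclass (zadd s x y) = mclass x + mclass y.
Proof. exact: zclassD. Qed.

Lemma mclass_surj : surjective mclass.
Proof. by move=> q; exists (zrep q); apply: zrepK. Qed.

Fact mq_scaleA r t q : mq_scale r (mq_scale t q) = mq_scale (r * t) q.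
Proof.
have [x <-] := mclass_surj q; rewrite !mq_scaleE.
exact/mclass_eq/zeq_scaleA.
Qed.
Fact mq_scale1 : left_id 1 mq_scale.
Proof.
move=> q; have [x <-] := mclass_surj q; rewrite mq_scaleE.
exact/mclass_eq/zeq_scale1.
Qed.
Fact mq_scaleDr : right_distributive mq_scale +%R.
Proof.
move=> r p q; have [x <-] := mclass_surj p; have [y <-] := mclass_surj q.
rewrite -mclassD !mq_scaleE -mclassD; exact/mclass_eq/zeq_scaleDr.
Qed.
Fact mq_scaleDl q : {morph mq_scale^~ q : r t / r + t}.
Proof.
move=> r t; have [x <-] := mclass_surj q.
rewrite !mq_scaleE -mclassD; exact/mclass_eq/zeq_scaleDl.
Qed.

HB.instance Definition _ := GRing.Zmodule_isLmodule.Build S mquot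
  mq_scaleA mq_scale1 mq_scaleDr mq_scaleDl.

Lemma mclassZ r x : mclass (mscale s r x) = r *: mclass x.
Proof. by rewrite -mq_scaleE. Qed.

End MQuotient.

Lemma linear_mk (S : pzRingType) (A B : lmodType S) (f : A -> B) :
  linear f -> exists g : {linear A -> B}, g =1 f.
Proof.
move=> fL; pose fM := GRing.isLinear.Build S A B *:%R f fL.
by pose F : {linear A -> B} := HB.pack f fM; exists F.
Qed.

Lemma additive_mk (A B : zmodType) (f : A -> B) :
  {morph f : x y / x + y} -> exists g : {additive A -> B}, g =1 f.
Proof.
move=> fD.
have fB : zmod_morphism f.
  have f0 : f 0 = 0 by apply: (addrI (f 0)); rewrite -fD !addr0.
  have fN x : f (- x) = - f x by apply: (addrI (f x)); rewrite -fD !subrr f0.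
  by move=> x y; rewrite fD fN.
pose fM := GRing.isZmodMorphism.Build A B f fB.
by pose F : {additive A -> B} := HB.pack f fM; exists F.
Qed.

Lemma mquot_lift (S : pzRingType) (X : Type) (s : msetoid S X)
    (Y : lmodType S) (f : X -> Y) :
  (forall x y, zeq s x y -> f x = f y) ->
  (forall x y, f (zadd s x y) = f x + f y) ->
  (forall r x, f (mscale s r x) = r *: f x) ->
  exists g : {linear mquot s -> Y}, forall x, g (mclass s x) = f x.
Proof.
move=> fe fD fZ; pose h (q : mquot s) := f (zrep q).
have hE x : h (mclass s x) = f x by apply/fe/zeq_rep.
have hL : linear h.
  move=> r p q; have [x <-] := mclass_surj p; have [y <-] := mclass_surj q.
  by rewrite -mclassZ -mclassD !hE fD fZ.
by have [g gE] := linear_mk hL; exists g => x; rewrite gE hE.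
Qed.

(** * Submodules and quotient modules *)

Definition submodule (S : pzRingType) (M : lmodType S) (P : M -> Prop) : Prop :=
  [/\ P 0, forall x y, P x -> P y -> P (x + y) & forall r x, P x -> P (r *: x)].

Lemma submoduleN (S : pzRingType) (M : lmodType S) (P : M -> Prop) x :
  submodule P -> P x -> P (- x).
Proof. by case=> _ _ PZ Px; rewrite -scaleN1r; apply: PZ. Qed.

Lemma submoduleB (S : pzRingType) (M : lmodType S) (P : M -> Prop) x y :
  submodule P -> P x -> P y -> P (x - y).
Proof. by move=> hP Px Py; case: (hP) => _ PD _; apply: PD => //; apply: submoduleN. Qed.

Lemma submodule_mk (S : pzRingType) (M : lmodType S) (P : M -> Prop) :
  submodule P ->
  exists (K : lmodType S) (i : {linear K -> M}),
    injective i /\ forall x, P x <-> exists k, i k = x.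
Proof.
move=> hP; have [P0 PD PZ] := hP; pose X := {x : M | P x}.
pose e (x y : X) := sval x = sval y.
pose ad (x y : X) : X := exist P _ (PD _ _ (proj2_sig x) (proj2_sig y)).
pose op (x : X) : X := exist P _ (submoduleN hP (proj2_sig x)).
pose sc r (x : X) : X := exist P _ (PZ r _ (proj2_sig x)).
have [zs zsE] : exists zs : zsetoid X,
    [/\ zeq zs = e, zadd zs = ad & zzero zs = exist P 0 P0].
  unshelve eexists (@ZSetoid X e (exist P 0 P0) ad op _ _ _ _ _ _ _ _ _) => //;
  rewrite /e /=.
  - by move=> x y z -> ->.
  - by move=> x x' y y' -> ->.
  - by move=> x x' ->.
  - by move=> x y z; rewrite addrA.
  - by move=> x y; rewrite addrC.
  - by move=> x; rewrite add0r.
  - by move=> x; rewrite addNr.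
case: zsE => eE aE _.
have [s [sE scE]] : exists s : msetoid S X, mzs s = zs /\ mscale s = sc.
  unshelve eexists (@MSetoid S X zs sc _ _ _ _ _) => //; rewrite ?eE ?aE /e /=.
  - by move=> r x y ->.
  - by move=> r t x; rewrite scalerA.
  - by move=> x; rewrite scale1r.
  - by move=> r x y; rewrite scalerDr.
  - by move=> x r t; rewrite scalerDl.
have [||| i iE] := @mquot_lift S X s M (fun x => sval x).
- by rewrite sE eE.
- by rewrite sE aE.
- by rewrite scE.
exists (mquot s : lmodType S), i; split=> [p q|x].
  have [x <-] := mclass_surj p; have [y <-] := mclass_surj q.
  by rewrite !iE => xy; apply/mclass_eq; rewrite sE eE.
split=> [Px|[q <-]]; first by exists (mclass s (exist P x Px)); rewrite iE.
by have [y <-] := mclass_surj q; rewrite iE; apply: proj2_sig.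
Qed.

Lemma quotient_mk (S : pzRingType) (M : lmodType S) (P : M -> Prop) :
  submodule P ->
  exists (Q : lmodType S) (q : {linear M -> Q}),
    surjective q /\ forall x, q x = 0 <-> P x.
Proof.
move=> hP; have [P0 PD PZ] := hP.
pose e (x y : M) := P (x - y).
have [zs [eE aE zE]] : exists zs : zsetoid M,
    [/\ zeq zs = e, zadd zs = +%R & zzero zs = 0].
  unshelve eexists (@ZSetoid M e 0 +%R -%R _ _ _ _ _ _ _ _ _) => //; rewrite /e.
  - by move=> x; rewrite subrr.
  - by move=> x y xy; rewrite -opprB; apply: submoduleN.
  - by move=> x y z xy yz; rewrite -(subrK y x) -addrA; apply: PD.
  - by move=> x x' y y' xx yy; rewrite opprD addrACA; apply: PD.
  - by move=> x x' xx; rewrite -opprD; apply: submoduleN.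
  - by move=> x y z; rewrite addrA subrr.
  - by move=> x y; rewrite (addrC y) subrr.
  - by move=> x; rewrite add0r subrr.
  - by move=> x; rewrite addNr subrr.
have [s [sE scE]] : exists s : msetoid S M, mzs s = zs /\ mscale s = *:%R.
  unshelve eexists (@MSetoid S M zs *:%R _ _ _ _ _) => //; rewrite ?eE ?aE /e /=.
  - by move=> r x y; rewrite -scalerBr; apply: PZ.
  - by move=> r t x; rewrite scalerA subrr.
  - by move=> x; rewrite scale1r subrr.
  - by move=> r x y; rewrite scalerDr subrr.
  - by move=> x r t; rewrite scalerDl subrr.
have cL : linear (mclass s : M -> mquot s).
  by move=> r x y; rewrite -mclassZ -mclassD scE sE aE.
have [q qE] := linear_mk cL.
exists (mquot s : lmodType S), q; split=> [p|x].
  by have [x <-] := mclass_surj p; exists x; rewrite qE.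
have q0 : q 0 = 0 by rewrite raddf0.
by rewrite -q0 !qE mclass_eq sE eE /e subr0.
Qed.

(** * Flatness by equations *)

Section Factors.
Variables (S : pzRingType) (I : finType) (r : I -> S).

Definition factors (M : lmodType S) (x : I -> M) : Prop :=
  exists (J : finType) (a : I -> J -> S) (y : J -> M),
    (forall i, x i = \sum_j a i j *: y j) /\
    (forall j, \sum_i r i * a i j = 0).

Lemma factors_sum (M : lmodType S) (x : I -> M) : factors x ->
  \sum_i r i *: x i = 0.
Proof.
move=> [J [a [y [xE ra]]]].
under eq_bigr do rewrite xE scaler_sumr.
rewrite exchange_big big1 // => j _.
by under eq_bigr do rewrite scalerA; rewrite -scaler_suml ra scale0r.
Qed.

Lemma eq_factors (M : lmodType S) (x y : I -> M) :
  x =1 y -> factors x -> factors y.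
Proof. by move=> /funext ->. Qed.

Lemma factors0 (M : lmodType S) : factors (fun=> 0 : M).
Proof.
exists void, (fun _ => of_void S), (of_void M).
by split=> [i|[]//]; rewrite big_pred0 // => -[].
Qed.

Lemma factorsD (M : lmodType S) (x y : I -> M) :
  factors x -> factors y -> factors (fun i => x i + y i).
Proof.
move=> [J [a [u [xE ra]]]] [K [b [v [yE rb]]]].
exists (J + K)%type, (fun i j => match j with inl j => a i j | inr k => b i k end),
  (fun j => match j with inl j => u j | inr k => v k end).
split=> [i|[j|k]]; by rewrite ?big_sumType /= ?xE ?yE.
Qed.

Lemma factors1 (M : lmodType S) (a : I -> S) (y : M) :
  \sum_i r i * a i = 0 -> factors (fun i => a i *: y).
Proof.
move=> ra; exists unit, (fun i _ => a i), (fun=> y).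
by split=> // i; rewrite (big_pred1 tt) // => -[].
Qed.

Lemma factors_big (M : lmodType S) (T : Type) (s : seq T) (x : T -> I -> M) :
  (forall t, factors (x t)) -> factors (fun i => \sum_(t <- s) x t i).
Proof.
move=> hx; elim: s => [|t s IHs].
  by apply: eq_factors (factors0 _) => i; rewrite big_nil.
by apply: eq_factors (factorsD (hx t) IHs) => i; rewrite big_cons.
Qed.

Lemma factors_linear (M N : lmodType S) (f : {linear M -> N}) (x : I -> M) :
  factors x -> factors (fun i => f (x i)).
Proof.
move=> [J [a [y [xE ra]]]]; exists J, a, (fun j => f (y j)); split=> // i.
by rewrite xE linear_sum; apply: eq_bigr => j _; rewrite linearZ.
Qed.

Lemma factorsN (M : lmodType S) (x : I -> M) :
  factors x -> factors (fun i => - x i).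
Proof.
move=> [J [a [y [xE ra]]]]; exists J, a, (fun j => - y j); split=> // i.
by rewrite xE -sumrN; apply: eq_bigr => j _; rewrite scalerN.
Qed.

End Factors.

Definition eqflat (S : pzRingType) (M : lmodType S) : Prop :=
  forall (I : finType) (r : I -> S) (x : I -> M),
    \sum_i r i *: x i = 0 -> factors r x.

Lemma sum_enum_val (V : zmodType) (J : finType) (F : J -> V) :
  \sum_j F j = \sum_(k < #|J|) F (enum_val k).
Proof. by rewrite -big_enum_val /=; apply: eq_bigl. Qed.

Lemma eqflat_ord (S : pzRingType) (M : lmodType S) :
  (forall n (r : 'I_n -> S) (x : 'I_n -> M),
    \sum_i r i *: x i = 0 -> factors r x) -> eqflat M.
Proof.
move=> hM I r x rx.
rewrite sum_enum_val in rx; have [J [a [y [xE ra]]]] := hM _ _ _ rx.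
exists J, (fun i => a (enum_rank i)), y; split=> [i|j].
  by rewrite -xE enum_rankK.
by rewrite sum_enum_val; under eq_bigr do rewrite enum_valK; apply: ra.
Qed.

Lemma eqflat_regular (S : pzRingType) : eqflat (S^o : lmodType S).
Proof.
move=> I r x rx; have : factors r (fun i => (x i : S) *: (1 : S^o)).
  exact: factors1.
by apply: eq_factors => i; rewrite /GRing.scale /= mulr1.
Qed.

Lemma eqflat_retract (S : pzRingType) (M N : lmodType S)
    (i : {linear N -> M}) (p : {linear M -> N}) :
  (forall x, p (i x) = x) -> eqflat M -> eqflat N.
Proof.
move=> pi hM I r x rx.
have : factors r (fun k => p (i (x k))).
  apply/factors_linear/hM; under eq_bigr do rewrite -linearZ.
  by rewrite -linear_sum rx linear0.
by apply: eq_factors.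
Qed.

(* Several relations are solved one after the other. *)
Lemma eqflat_system (S : pzRingType) (M : lmodType S) (I K : finType)
    (r : K -> I -> S) (x : I -> M) :
  eqflat M -> (forall k, \sum_i r k i *: x i = 0) ->
  exists (J : finType) (a : I -> J -> S) (y : J -> M),
    (forall i, x i = \sum_j a i j *: y j) /\
    (forall k j, \sum_i r k i * a i j = 0).
Proof.
move=> hM rx.
suff [J [a [y [xE ra]]]] : exists (J : finType) (a : I -> J -> S) (y : J -> M),
    (forall i, x i = \sum_j a i j *: y j) /\
    (forall k, k \in enum K -> forall j, \sum_i r k i * a i j = 0).
  by exists J, a, y; split=> // k; apply: ra; rewrite mem_enum.
elim: (enum K) => [|k s [J [a [y [xE ra]]]]].
  exists I, (fun i j => (i == j)%:R), x; split=> // i.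
  rewrite (bigD1 i) //= eqxx scale1r big1 ?addr0 // => j.
  by rewrite eq_sym => /negPf->; rewrite scale0r.
have : \sum_j (\sum_i r k i * a i j) *: y j = 0.
  rewrite -[RHS](rx k).
  under eq_bigr do rewrite scaler_suml.
  rewrite exchange_big; apply: eq_bigr => i _; rewrite xE scaler_sumr.
  by apply: eq_bigr => j _; rewrite scalerA.
move=> /hM[L [b [z [yE rb]]]].
exists L, (fun i l => \sum_j a i j * b j l), z; split=> [i|k'].
  rewrite xE; under eq_bigr do rewrite yE scaler_sumr.
  rewrite exchange_big; apply: eq_bigr => l _; rewrite scaler_suml.
  by apply: eq_bigr => j _; rewrite scalerA.
have swap l : \sum_i r k' i * (\sum_j a i j * b j l) =
    \sum_j (\sum_i r k' i * a i j) * b j l.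
  under eq_bigr do rewrite mulr_sumr.
  rewrite exchange_big; apply: eq_bigr => j _; rewrite mulr_suml.
  by apply: eq_bigr => i _; rewrite mulrA.
rewrite inE => /orP[/eqP kk l|k's l]; rewrite swap; first by rewrite kk rb.
by rewrite big1 // => j _; rewrite ra // mul0r.
Qed.

(** Factor the image of the relation in [C] and lift the factorization to [c] in [B]. Then [b - c]
    comes from [A] and satisfies the relation too, because [c] does. *)
Lemma eqflat_extension (S : pzRingType) (A B C : lmodType S)
    (i : {linear A -> B}) (p : {linear B -> C}) :
  injective i -> surjective p -> exact_at i p ->
  eqflat A -> eqflat C -> eqflat B.
Proof.
move=> iI pS ip hA hC I r b rb.
have : \sum_k r k *: p (b k) = 0.
  by under eq_bigr do rewrite -linearZ; rewrite -linear_sum rb linear0.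
move=> /hC[J [a [y [bE ra]]]]; have [u uE] := choice (fun j => pS (y j)).
pose c k := \sum_j a k j *: u j.
have fc : factors r c by exists J, a, u.
have /choice[d dE] k : exists d, i d = b k - c k.
  apply/ip; rewrite linearB /= bE linear_sum /=; apply/eqP; rewrite subr_eq0.
  by apply/eqP/eq_bigr => j _; rewrite linearZ uE.
have fd : factors r d.
  apply: hA; apply: iI; rewrite linear0 linear_sum.
  under eq_bigr do rewrite linearZ /= dE scalerBr.
  by rewrite sumrB rb (factors_sum fc) subr0.
apply: eq_factors (factorsD fc (factors_linear i fd)) => k.
by rewrite dE addrC subrK.
Qed.

(** After factoring in [B], the coefficients [a] give relations between the [p (b j)], since the
    [i (x k)] die in [C]. Factoring this system in [C] and subtracting a lift moves the [b j] into
    [A]; the correction cancels since [a] kills the new coefficients. *)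
Lemma eqflat_kernel (S : pzRingType) (A B C : lmodType S)
    (i : {linear A -> B}) (p : {linear B -> C}) :
  injective i -> surjective p -> exact_at i p ->
  eqflat B -> eqflat C -> eqflat A.
Proof.
move=> iI pS ip hB hC I r x rx.
have : \sum_k r k *: i (x k) = 0.
  by under eq_bigr do rewrite -linearZ; rewrite -linear_sum rx linear0.
move=> /hB[J [a [b [xE ra]]]].
have ab k : \sum_j a k j *: p (b j) = 0.
  under eq_bigr do rewrite -linearZ; rewrite -linear_sum -xE.
  by apply/ip; exists (x k).
have [L [c [y [bE ac]]]] := eqflat_system hC ab.
have [u uE] := choice (fun j => pS (y j)).
have /choice[d dE] j : exists d, i d = b j - \sum_l c j l *: u l.
  apply/ip; rewrite linearB /= bE linear_sum /=; apply/eqP; rewrite subr_eq0.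
  by apply/eqP/eq_bigr => l _; rewrite linearZ uE.
exists J, a, d; split=> // k; apply: iI; rewrite linear_sum xE.
under [RHS]eq_bigr do rewrite linearZ /= dE scalerBr.
rewrite sumrB [X in _ - X](_ : _ = 0) ?subr0 //.
under eq_bigr do rewrite scaler_sumr.
rewrite exchange_big big1 // => l _.
by under eq_bigr do rewrite scalerA; rewrite -scaler_suml ac scale0r.
Qed.

(** * Existence of flat precovers *)

Definition pick_or (T : Type) (x0 : T) (P : T -> Prop) : T :=
  if pselect (exists x, P x) is left exP then projT1 (cid exP) else x0.

Lemma pick_orP (T : Type) (x0 : T) (P : T -> Prop) :
  (exists x, P x) -> P (pick_or x0 P).
Proof. by rewrite /pick_or; case: pselect => // exP _; case: cid. Qed.

(** Flatness of [M/P], said inside [M]: the hypothesis and the conclusion involve finitely many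
    elements, so the property passes to unions of chains. *)
Definition flat_quotient (S : pzRingType) (M : lmodType S) (P : M -> Prop) :=
  forall n (r : 'I_n -> S) (x : 'I_n -> M), P (\sum_i r i *: x i) ->
    exists2 c, factors r c & forall i, P (x i - c i).

Lemma eqflat_quotient (S : pzRingType) (M Q : lmodType S) (P : M -> Prop)
    (q : {linear M -> Q}) :
  surjective q -> (forall x, q x = 0 <-> P x) -> flat_quotient P -> eqflat Q.
Proof.
move=> qS qP hP; apply: eqflat_ord => n r x rx.
have [u uE] := choice (fun i => qS (x i)).
have /hP[c rc xc] : P (\sum_i r i *: u i).
  apply/qP; rewrite linear_sum -[RHS]rx.
  by apply: eq_bigr => i _; rewrite linearZ uE.
apply: eq_factors (factors_linear q rc) => i.
have /qP/eqP := xc i.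
by rewrite linearB subr_eq0 => /eqP; rewrite uE.
Qed.

(** The quotient of [M] by the preimage of [D] is the quotient of [Q] by [D]. *)
Lemma flat_quotient_preim (S : pzRingType) (M Q : lmodType S)
    (q : {linear M -> Q}) (D : Q -> Prop) :
  surjective q -> flat_quotient D -> flat_quotient (fun x => D (q x)).
Proof.
move=> qS hD n r x.
rewrite linear_sum; under eq_bigr do rewrite linearZ.
move=> /(hD _ r (fun i => q (x i)))[c [J [a [y [cE ra]]]] xc].
have [u uE] := choice (fun j => qS (y j)).
exists (fun i => \sum_j a i j *: u j); first by exists J, a, u.
move=> i; rewrite linearB linear_sum /=.
by under eq_bigr do rewrite linearZ /= uE; rewrite -cE.
Qed.

(* Terms for the elements of a small submodule that is pure modulo a given    *)
(* submodule: [PSol r i p] stands for the i-th entry of a solution of         *)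
(* [\sum_i r i *: y i = p].                                                   *)
Inductive pterm (S : pzRingType) : Type :=
| PVar
| PAdd of pterm S & pterm S
| PScale of S & pterm S
| PSol n of 'I_n -> S & 'I_n & pterm S.

(* Terms for the elements of a submodule [G] that contains, with every        *)
(* [pterm]-indexed family [e], a copy of [e] which agrees with [e] where it   *)
(* takes values in [G] and has the same image in [N].                         *)
Inductive wterm (S : pzRingType) (N : Type) : Type :=
| WZero
| WAdd of wterm S N & wterm S N
| WScale of S & wterm S N
| WSol n of 'I_n -> S & 'I_n & wterm S N
| WCopy of (pterm S -> bool) & (pterm S -> N) & (pterm S -> wterm S N) & pterm S.

Section SmallFlat.
Variables (S : pzRingType) (F N : lmodType S) (f : {linear F -> N}).

Fixpoint peval (G : F -> Prop) (x : F) (p : pterm S) : F :=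
  match p with
  | PVar => x
  | PAdd p q => peval G x p + peval G x q
  | PScale r p => r *: peval G x p
  | PSol n r i p =>
      pick_or (fun=> 0) (fun y : 'I_n -> F =>
        G (\sum_i r i *: y i - peval G x p)) i
  end.

Definition plinear (e : pterm S -> F) : Prop :=
  (forall p q, e (PAdd p q) = e p + e q) /\
  (forall r p, e (PScale r p) = r *: e p).

Fixpoint weval (w : wterm S N) : F :=
  match w with
  | WZero => 0
  | WAdd u v => weval u + weval v
  | WScale r u => r *: weval u
  | WSol n r i u =>
      pick_or (fun=> 0) (fun y : 'I_n -> F =>
        \sum_i r i *: y i = weval u) i
  | WCopy D nu d p =>
      pick_or (fun=> 0) (fun e : pterm S -> F =>
        [/\ plinear e, forall p, D p -> e p = weval (d p)
          & forall p, f (e p) = nu p]) p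
  end.

Let G (x : F) : Prop := exists w, weval w = x.

Let G_submodule : submodule G.
Proof.
split=> [|_ _ [u <-] [v <-]|r _ [u <-]]; first by exists (WZero S N).
- by exists (WAdd u v).
- by exists (WScale r u).
Qed.

Let G_pure n (r : 'I_n -> S) (x : 'I_n -> F) : G (\sum_i r i *: x i) ->
  exists2 y, forall i, G (y i) & \sum_i r i *: y i = \sum_i r i *: x i.
Proof.
move=> [w wE]; exists (fun i => weval (WSol r i w)).
  by move=> i; exists (WSol r i w).
rewrite -wE /=; set P := fun y : 'I_n -> F => _.
by apply: (@pick_orP _ (fun=> 0) P); exists x.
Qed.

Let G_copy (e : pterm S -> F) : plinear e ->
  exists e', [/\ plinear e', forall p, G (e' p), forall p, G (e p) -> e' p = e p
    & forall p, f (e' p) = f (e p)].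
Proof.
move=> eL; have /choice[d dE] p : exists w, G (e p) -> weval w = e p.
  by case: (pselect (G (e p))) => [[w <-]|nG]; [exists w | exists (WZero S N)].
pose D p := `[< G (e p) >]; pose nu p := f (e p).
pose P (e : pterm S -> F) := [/\ plinear e,
  forall p, D p -> e p = weval (d p) & forall p, f (e p) = nu p].
have eP : P e by split=> // p /asboolP /dE.
have [e'L e'D e'f] : P (pick_or (fun=> 0) P) by apply: pick_orP; exists e.
exists (pick_or (fun=> 0) P); split=> // p; first by exists (WCopy D nu d p).
by move=> ep; rewrite e'D ?dE //; apply/asboolP.
Qed.

(* If [x] is not in [G], the differences between a small submodule [e]        *)
(* through [x] and its copy in [G] form a nonzero submodule of the kernel     *)
(* which is a direct summand of a submodule with flat quotient.               *)
Lemma weval_surj : eqflat F ->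
  (forall D, submodule D -> (forall x, D x -> f x = 0) -> flat_quotient D ->
     forall x, D x -> x = 0) ->
  surjective weval.
Proof.
move=> hF minF x; apply: contrapT => nGx.
have [G0 GD GZ] := G_submodule.
pose e := peval G x; have eL : plinear e by [].
have [eD eZ] := eL.
have [e' [[e'D e'Z] Ge' e'G e'f]] := G_copy eL.
pose D y := exists p, y = e p - e' p.
have Dsub : submodule D.
  split=> [|_ _ [p ->] [q ->]|r _ [p ->]].
  - by exists (PScale 0 (PVar S)); rewrite eZ e'Z !scale0r subrr.
  - by exists (PAdd p q); rewrite eD e'D opprD addrACA.
  - by exists (PScale r p); rewrite eZ e'Z scalerBr.
have [D0 DD DZ] := Dsub.
have DG y : D y -> G y -> y = 0.
  move=> [p ->] Gy; have : G (e p) by rewrite -(subrK (e' p) (e p)); apply: GD.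
  by move=> /e'G->; rewrite subrr.
have Dx : D (x - e' (PVar S)) by exists (PVar S).
have /(_ _ Dx)/eqP : forall y, D y -> y = 0; last first.
  by rewrite subr_eq0 => /eqP xE; apply: nGx; rewrite xE; apply: Ge'.
apply: minF => // [_ [p ->]|n r y [p yE]]; first by rewrite linearB /= e'f subrr.
(* Modulo [D], [y i] may be replaced by [y i - (e (t i) - e' (t i))], which is a sum of two factored
   families. The first, [fa], is a relation by the choice of [z]; the second, [fb], is one because
   its combination lies in both [D] and [G], which meet in 0. *)
pose t i := PSol r i p.
have Gt : G (\sum_i r i *: e (t i) - e p).
  pose P (z : 'I_n -> F) := G (\sum_i r i *: z i - e p).
  apply: (@pick_orP _ (fun=> 0) P); exists y.
  by rewrite /P yE addrC addKr; apply: submoduleN.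
have /G_pure[z Gz zE] : G (\sum_i r i *: (y i - e (t i))).
  under eq_bigr do rewrite scalerBr.
  rewrite sumrB yE (addrC (e p)) -addrA -(opprB _ (e p)).
  by apply: submoduleB => //; apply: submoduleN.
have fa : factors r (fun i => y i - e (t i) - z i).
  apply: hF; under eq_bigr do rewrite scalerBr.
  by rewrite sumrB zE subrr.
have fb : factors r (fun i => e' (t i) + z i).
  apply: hF; apply: DG; last first.
    elim/big_ind : _ => // i _; apply: GZ; exact: GD.
  have -> : \sum_i r i *: (e' (t i) + z i) =
      (e p - e' p) - \sum_i r i *: (e (t i) - e' (t i)).
    rewrite -yE -sumrB.
    under [RHS]eq_bigr do rewrite -scalerBr.
    rewrite -[LHS]addr0 -[X in _ + X](factors_sum fa) -big_split /=.
    apply: eq_bigr => i _; rewrite -scalerDr; congr (_ *: _).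
    by rewrite addrC (addrC (e' _)) addrA subrK opprB -addrA (addrC (- e _)).
  apply: submoduleB => //; first by exists p.
  by elim/big_ind : _ => // i _; apply: DZ; exists (t i).
exists (fun i => (y i - e (t i) - z i) + (e' (t i) + z i)).
  exact: factorsD.
move=> i; exists (t i); rewrite (addrC (e' _)) addrA subrK opprD opprB.
by rewrite addrA (addrC (y i)) subrK.
Qed.

End SmallFlat.

(** Zorn's lemma applies: the zero submodule qualifies because [F] is flat, and unions of chains
    inherit all three conditions. *)
Lemma maximal_flat_quotient (S : pzRingType) (F N : lmodType S)
    (f : {linear F -> N}) :
  eqflat F ->
  exists K : F -> Prop, [/\ submodule K, forall x, K x -> f x = 0,
    flat_quotient K
    & forall D : F -> Prop, submodule D -> (forall x, D x -> f x = 0) ->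
        flat_quotient D -> (forall x, K x -> D x) -> forall x, D x -> K x].
Proof.
move=> hF.
pose good (A : set F) :=
  [/\ submodule A, forall x, A x -> f x = 0 & flat_quotient A].
have good0 : good (fun x : F => x = 0).
  split=> [||n r x rx].
  - by split=> [//|_ _ -> ->|r _ ->]; rewrite ?addr0 ?scaler0.
  - by move=> _ ->; rewrite linear0.
  - by exists x => [|i]; [apply: hF | apply: subrr].
have [|A [AP Amax]] := @Zorn_bigcup F (fun A => A = set0 \/ good A).
  move=> C CP Ctot.
  have [[B0 CB0 gB0]|nB] := pselect (exists2 B, C B & good B); last first.
    left; apply/seteqP; split=> // x [B CB Bx].
    by have [B0|gB] := CP B CB; [rewrite B0 in Bx | case: nB; exists B].
  have gC B x : C B -> B x -> good B.
    by move=> CB Bx; have [B0e|//] := CP B CB; rewrite B0e in Bx.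
  right; split=> [|x [B CB Bx]|n r x [B CB Bx]].
  - split=> [|x y [B CB Bx] [B' CB' By]|r x [B CB Bx]].
    + by exists B0 => //; have [[]] := gB0.
    + have [BB|BB] := Ctot B B' CB CB'.
        by exists B' => //; have [[_ BD _] _ _] := gC _ _ CB' By; apply/BD/By/BB.
      by exists B => //; have [[_ BD _] _ _] := gC _ _ CB Bx; apply/BD/BB.
    + by exists B => //; have [[_ _ BZ] _ _] := gC _ _ CB Bx; apply: BZ.
  - by have [_ Bf _] := gC _ _ CB Bx; apply: Bf.
  - have [_ _ Bq] := gC _ _ CB Bx; have [c rc xc] := Bq _ _ _ Bx.
    by exists c => // i; exists B.
have [Asub Af Aq] : good A.
  case: AP => // A0; exfalso.
  apply: (Amax (fun x : F => x = 0)); last by right.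
  by rewrite A0; split=> // /(_ 0 erefl).
exists A; split=> // D Dsub Df Dq AD x Dx; apply: contrapT => nAx.
by apply: (Amax D); [split=> // DA; apply/nAx/DA | right].
Qed.

(** Take the quotient by a maximal [K]. A nonzero submodule of the kernel of [g] with flat quotient
    would pull back to one larger than [K], so [weval_surj] applies to [Q]. *)
Lemma factor_through_small (S : pzRingType) (F N : lmodType S)
    (f : {linear F -> N}) :
  eqflat F ->
  exists (Q : lmodType S) (q : {linear F -> Q}) (g : {linear Q -> N}),
    [/\ eqflat Q, forall x, g (q x) = f x & surjective (weval g)].
Proof.
move=> hF; have [K [Ksub Kf Kq Kmax]] := maximal_flat_quotient f hF.
have [Q [q [qS qK]]] := quotient_mk Ksub.
have [u uE] := choice qS.
have fq x y : q x = q y -> f x = f y.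
  move=> xy; apply/eqP; rewrite -subr_eq0 -linearB; apply/eqP/Kf/qK.
  by rewrite linearB /= xy subrr.
have gL : linear (fun y => f (u y)).
  by move=> r x y; rewrite -linearP; apply: fq; rewrite linearP /= !uE.
have [g gE] := linear_mk gL.
have gq x : g (q x) = f x by rewrite gE; apply/fq/uE.
have hQ : eqflat Q by apply: eqflat_quotient Kq.
exists Q, q, g; split=> //; apply: weval_surj => // D [D0 DD DZ] Df Dq y Dy.
have [x xE] := qS y; rewrite -xE in Dy *; apply/qK.
apply: (Kmax (fun x => D (q x))) => //.
- split=> [|x' y'|r x']; first by rewrite linear0.
    by rewrite linearD; apply: DD.
  by rewrite linearZ; apply: DZ.
- by move=> x' /Df; rewrite gq.
- exact: flat_quotient_preim.
- by move=> x' /qK->.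
Qed.

(** Transports the structure of [Q] to [W] along a section of [v], so that every image of [W] is
    isomorphic to a quotient listed by [msetoid S W]. *)
Lemma mquot_code (S : pzRingType) (W : Type) (Q : lmodType S) (v : W -> Q) :
  surjective v ->
  exists (s : msetoid S W) (g : {linear Q -> mquot s})
    (h : {linear mquot s -> Q}), cancel g h /\ cancel h g.
Proof.
move=> /choice[u uE]; pose e x y := v x = v y.
have [zs [eE aE]] : exists zs : zsetoid W,
    zeq zs = e /\ zadd zs = fun x y => u (v x + v y).
  unshelve eexists (@ZSetoid W e (u 0) (fun x y => u (v x + v y))
    (fun x => u (- v x)) _ _ _ _ _ _ _ _ _) => //; rewrite /e.
  - by move=> x y z -> ->.
  - by move=> x x' y y' -> ->.
  - by move=> x x' ->.
  - by move=> x y z; rewrite !uE addrA.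
  - by move=> x y; rewrite addrC.
  - by move=> x; rewrite !uE add0r.
  - by move=> x; rewrite !uE addNr.
have [s [sE scE]] : exists s : msetoid S W,
    mzs s = zs /\ mscale s = fun r x => u (r *: v x).
  unshelve eexists (@MSetoid S W zs (fun r x => u (r *: v x)) _ _ _ _ _) => //;
    rewrite eE ?aE /e.
  - by move=> r x y ->.
  - by move=> r t x; rewrite !uE scalerA.
  - by move=> x; rewrite uE scale1r.
  - by move=> r x y; rewrite !uE scalerDr.
  - by move=> x r t; rewrite !uE scalerDl.
have gL : linear (fun q => mclass s (u q) : mquot s).
  move=> r x y; rewrite -mclassZ -mclassD; apply/mclass_eq.
  by rewrite sE eE aE scE /e !uE.
have [g gE] := linear_mk gL.
have [||| h hE] := @mquot_lift S W s Q v.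
- by rewrite sE eE.
- by move=> x y; rewrite sE aE uE.
- by move=> r x; rewrite scE uE.
exists s, g, h; split=> [q|p]; first by rewrite gE hE uE.
have [x <-] := mclass_surj p; rewrite gE; apply/mclass_eq.
by rewrite sE eE /e uE hE.
Qed.

(** * Direct sums and their flatness *)

Section Delta.
Variables (S : pzRingType) (I : Type) (E : I -> lmodType S).

Definition delta (i j : I) : {linear E i -> E j} :=
  match pselect (i = j) with
  | left e => match e in _ = j return {linear E i -> E j} with
              | erefl => idfun
              end
  | right _ => \0
  end.

Lemma delta_same i x : delta i i x = x.
Proof. by rewrite /delta; case: pselect => // e; rewrite (Prop_irrelevance e erefl). Qed.

Lemma delta_diff i j x : i <> j -> delta i j x = 0.
Proof. by rewrite /delta; case: pselect. Qed.

End Delta.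

(** Elements are formal sums, identified when every family of linear maps into every module gives
    them the same value; the lifting property then holds by construction. *)
Lemma direct_sum_mk (S : pzRingType) (I : Type) (E : I -> lmodType S) :
  exists (D : lmodType S) (inj : forall i, {linear E i -> D}),
    (forall (Y : lmodType S) (k : forall i, {linear E i -> Y}),
       exists h : {linear D -> Y}, forall i x, h (inj i x) = k i x) /\
    (forall d, exists s : seq {i & E i},
       d = \sum_(p <- s) inj (tag p) (tagged p)).
Proof.
pose T := {i : I & E i}; pose X := seq T.
pose ev (Y : lmodType S) (k : forall i, {linear E i -> Y}) (s : X) :=
  \sum_(p <- s) k (tag p) (tagged p).
pose e (s t : X) := forall Y k, @ev Y k s = ev Y k t.
pose op (s : X) : X := [seq existT E (tag p) (- tagged p) : T | p : T <- s].
pose sc r (s : X) : X := [seq existT E (tag p) (r *: tagged p) : T | p : T <- s].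
have evN Y k s : @ev Y k (op s) = - ev Y k s.
  by rewrite /ev big_map -sumrN; apply: eq_bigr => p _; rewrite linearN.
have evZ Y k r s : @ev Y k (sc r s) = r *: ev Y k s.
  by rewrite /ev big_map scaler_sumr; apply: eq_bigr => p _; rewrite linearZ.
have evD Y k s t : @ev Y k (s ++ t) = ev Y k s + ev Y k t.
  by rewrite /ev big_cat.
have [zs [eE aE zE]] : exists zs : zsetoid X,
    [/\ zeq zs = e, zadd zs = cat & zzero zs = [::]].
  unshelve eexists (@ZSetoid X e [::] cat op _ _ _ _ _ _ _ _ _) => //; rewrite /e.
  - by move=> x y xy Y k; rewrite xy.
  - by move=> x y z xy yz Y k; rewrite xy.
  - by move=> x x' y y' xx yy Y k; rewrite !evD xx yy.
  - by move=> x x' xx Y k; rewrite !evN xx.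
  - by move=> x y z Y k; rewrite catA.
  - by move=> x y Y k; rewrite !evD addrC.
  - by move=> x Y k; rewrite evD evN addNr /ev big_nil.
have [s [sE scE]] : exists s : msetoid S X, mzs s = zs /\ mscale s = sc.
  unshelve eexists (@MSetoid S X zs sc _ _ _ _ _) => //; rewrite eE ?aE /e.
  - by move=> r x y xy Y k; rewrite !evZ xy.
  - by move=> r t x Y k; rewrite !evZ scalerA.
  - by move=> x Y k; rewrite evZ scale1r.
  - by move=> r x y Y k; rewrite evD !evZ evD scalerDr.
  - by move=> x r t Y k; rewrite evD !evZ scalerDl.
pose inj i x : mquot s := mclass s [:: existT E i x : T].
have injL i : linear (inj i).
  move=> r x y; rewrite -mclassZ -mclassD; apply/mclass_eq.
  rewrite sE eE aE scE => Y k.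
  by rewrite /ev /= !big_cons !big_nil !addr0 /= linearP linearZ.
have [injl injlE] : exists f : forall i, {linear E i -> mquot s},
    forall i, f i =1 inj i.
  exists (fun i => projT1 (cid (linear_mk (injL i)))) => i; by case: cid.
exists (mquot s : lmodType S), injl; split=> [Y k|d].
  have [||| h hE] := @mquot_lift S X s Y (ev Y k).
  - by rewrite sE eE => x y xy; apply: xy.
  - by move=> x y; rewrite sE aE evD.
  - by move=> r x; rewrite scE evZ.
  by exists h => i x; rewrite injlE hE /ev big_seq1.
have [t <-] := mclass_surj d; exists t.
elim: t => [|[i x] t IHt]; first by rewrite big_nil -zE -sE.
rewrite big_cons -IHt injlE /inj /= -mclassD sE aE //.
Qed.

(** A relation meets only finitely many summands, and its projection to each of them is factored
    there. The projections [pr] come from the lifting property itself. *)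
Lemma direct_sum_eqflat (S : pzRingType) (I : eqType) (E : I -> lmodType S)
    (D : lmodType S) (inj : forall i, {linear E i -> D}) :
  (forall (Y : lmodType S) (k : forall i, {linear E i -> Y}),
     exists h : {linear D -> Y}, forall i x, h (inj i x) = k i x) ->
  (forall d, exists s : seq {i & E i},
     d = \sum_(p <- s) inj (tag p) (tagged p)) ->
  (forall i, eqflat (E i)) -> eqflat D.
Proof.
move=> lift gen hE.
have [pr prE] : exists pr : forall j, {linear D -> E j},
    forall j i x, pr j (inj i x) = delta E i j x.
  exists (fun j => projT1 (cid (lift (E j) (fun i => delta E i j)))) => j.
  by case: cid.
move=> K r x rx; have [s sE] := choice (fun k => gen (x k)).
pose l := undup [seq tag p | p <- flatten [seq s k | k <- enum K]].
have xE k : x k = \sum_(i <- l) inj i (pr i (x k)).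
  rewrite [in RHS]sE; under [RHS]eq_bigr do rewrite !linear_sum.
  rewrite exchange_big [LHS]sE; apply: eq_big_seq => p pk.
  rewrite (bigD1_seq (tag p)) ?undup_uniq //=; last first.
    rewrite mem_undup; apply: map_f; apply/flatten_mapP.
    by exists k; rewrite ?mem_enum.
  rewrite prE delta_same big1 ?addr0 // => i /eqP ip.
  by rewrite prE delta_diff ?linear0 //; apply: nesym.
have : factors r (fun k => \sum_(i <- l) inj i (pr i (x k))).
  apply: factors_big => i; apply: factors_linear; apply: hE.
  under eq_bigr do rewrite -linearZ.
  by rewrite -linear_sum rx linear0.
by apply: eq_factors => k; rewrite -xE.
Qed.

Section PrecoverIndex.
Variables (S : pzRingType) (N : lmodType S).

(** Up to isomorphism, all flat images of [wterm S N] together with all their maps to [N]. *)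
Definition precover_index : Type :=
  {s : msetoid S (wterm S N) & {h : {linear mquot s -> N} | eqflat (mquot s)}}.

HB.instance Definition _ := gen_eqMixin precover_index.

End PrecoverIndex.

Theorem flat_precover_exists (S : pzRingType) (N : lmodType S) :
  exists (F : lmodType S) (g : {linear F -> N}), precover (@eqflat S) g.
Proof.
pose E (i : precover_index N) : lmodType S := mquot (projT1 i).
have [D [inj [lift gen]]] := direct_sum_mk E.
have hD : eqflat D.
  by apply: direct_sum_eqflat lift gen _ => i; apply: proj2_sig (projT2 i).
have [g gE] := lift N (fun i => sval (projT2 i)).
exists D, g; split=> // F hF f.
have [Q [q [k [hQ kq kS]]]] := factor_through_small f hF.
have [s [a [b [ab ba]]]] := mquot_code kS.
have hs : eqflat (mquot s) by apply: (eqflat_retract (i := b) (p := a)).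
pose i : precover_index N := existT _ s (exist _ (k \o b : {linear _ -> _}) hs).
exists (inj i \o (a \o q) : {linear _ -> _}) => x /=.
by rewrite gE /= ab kq.
Qed.

(** * Flatness by tensor products *)

(* [sg] is an anti-isomorphism: the identity [R -> R^c] for left flatness and  *)
(* [R^c -> R] for right flatness.                                              *)
Section Tensors.
Variables (S T : pzRingType) (sg : S -> T).
Hypothesis sgD : {morph sg : r t / r + t}.
Hypothesis sg1 : sg 1 = 1.
Hypothesis sgM : forall r t, sg (r * t) = sg t * sg r.
Hypothesis sg_surj : surjective sg.
Hypothesis sg_inj : injective sg.

Let sg0 : sg 0 = 0.
Proof. by apply: (addrI (sg 0)); rewrite -sgD !addr0. Qed.

Let sg_sum (J : finType) (F : J -> S) : sg (\sum_j F j) = \sum_j sg (F j).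
Proof. exact: (big_morph sg sgD sg0). Qed.

Section Pair.
Variables (A : lmodType T) (M : lmodType S).

Definition tbalanced (U : zmodType) (b : A -> M -> U) : Prop :=
  [/\ forall a a' m, b (a + a') m = b a m + b a' m,
      forall a m m', b a (m + m') = b a m + b a m'
    & forall a r m, b (sg r *: a) m = b a (r *: m)].

Definition ttensor (U : zmodType) (b : A -> M -> U) : Prop :=
  tbalanced b /\
  forall (V : zmodType) (c : A -> M -> V), tbalanced c ->
    exists g : {additive U -> V},
      (forall a m, g (b a m) = c a m) /\
      forall h : {additive U -> V}, (forall a m, h (b a m) = c a m) -> h =1 g.

Lemma tbalanced0l (U : zmodType) (b : A -> M -> U) m : tbalanced b -> b 0 m = 0.
Proof. by case=> bD _ _; apply: (addrI (b 0 m)); rewrite -bD !addr0. Qed.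

Lemma tbalanced0r (U : zmodType) (b : A -> M -> U) a : tbalanced b -> b a 0 = 0.
Proof. by case=> _ bD _; apply: (addrI (b a 0)); rewrite -bD !addr0. Qed.

Lemma tbalancedNl (U : zmodType) (b : A -> M -> U) a m :
  tbalanced b -> b (- a) m = - b a m.
Proof.
move=> hb; apply: (addrI (b a m)); have [bD _ _] := hb.
by rewrite -bD !subrr tbalanced0l.
Qed.

Lemma tbalanced_sumr (U : zmodType) (b : A -> M -> U) (J : finType) a
    (F : J -> M) : tbalanced b -> b a (\sum_j F j) = \sum_j b a (F j).
Proof.
move=> hb; have [_ bD _] := hb.
by apply: (big_morph (b a)) => [m m'|]; [apply: bD | apply: tbalanced0r].
Qed.

(** The projection of [U] modulo the span and the zero map both extend the zero balanced map, so by
    uniqueness they agree. *)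
Lemma ttensor_gen (U : zmodType) (b : A -> M -> U) (x : U) : ttensor b ->
  exists s : seq (A * M), x = \sum_(p <- s) b p.1 p.2.
Proof.
move=> [hb ub].
pose span x := exists s : seq (A * M), x = \sum_(p <- s) b p.1 p.2.
have span0 : span 0 by exists [::]; rewrite big_nil.
have spanD y z : span y -> span z -> span (y + z).
  by move=> [s ->] [t ->]; exists (s ++ t); rewrite big_cat.
have spanN y : span y -> span (- y).
  move=> [s ->]; exists [seq (- p.1, p.2) | p <- s].
  by rewrite big_map -sumrN; apply: eq_bigr => p _; rewrite tbalancedNl.
have [zs [eE aE zE]] : exists zs : zsetoid U,
    [/\ zeq zs = (fun y z => span (y - z)), zadd zs = +%R & zzero zs = 0].
  unshelve eexists (@ZSetoid U (fun y z => span (y - z)) 0 +%R -%R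
    _ _ _ _ _ _ _ _ _) => //=.
  - by move=> y; rewrite subrr.
  - by move=> y z yz; rewrite -opprB; apply: spanN.
  - by move=> y z t yz zt; rewrite -(subrK z y) -addrA; apply: spanD.
  - by move=> y y' z z' yy zz; rewrite opprD addrACA; apply: spanD.
  - by move=> y y' yy; rewrite -opprD; apply: spanN.
  - by move=> y z t; rewrite addrA subrr.
  - by move=> y z; rewrite (addrC z) subrr.
  - by move=> y; rewrite add0r subrr.
  - by move=> y; rewrite addNr subrr.
have [q qE] : exists q : {additive U -> zquot zs}, q =1 zclass zs.
  by apply: additive_mk => y z; rewrite -zclassD aE.
have [] := ub (zquot zs) (fun _ _ => 0).
  by split=> *; rewrite ?addr0.
move=> g [_ gU].
have q0 : q =1 g.
  apply: gU => a m; rewrite qE -zclass0 zE; apply/zclass_eq; rewrite eE subr0.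
  by exists [:: (a, m)]; rewrite big_seq1.
have z0 : \0 =1 g by apply: gU.
have : zclass zs x = zclass zs 0 by rewrite -qE q0 -z0 -zE.
by move=> /zclass_eq; rewrite eE subr0.
Qed.

(* [coords y s v]: expanding each [m] in [s] along [y] turns the formal sum   *)
(* of the [b (x) m] into the sum of the [v j (x) y j].                        *)
Fixpoint coords (J : finType) (y : J -> M) (s : seq (A * M)) (v : J -> A) : Prop :=
  if s is p :: s' then
    exists2 c : J -> S, p.2 = \sum_j c j *: y j
                      & coords y s' (fun j => v j - sg (c j) *: p.1)
  else forall j, v j = 0.

Lemma eq_coords (J : finType) (y : J -> M) s (u v : J -> A) :
  u =1 v -> coords y s u -> coords y s v.
Proof. by move=> /funext->. Qed.

Lemma coords_cat (J : finType) (y : J -> M) s t (u v : J -> A) :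
  coords y s u -> coords y t v -> coords y (s ++ t) (fun j => u j + v j).
Proof.
elim: s u => [|p s IHs] u /=.
  by move=> u0; apply: eq_coords => j; rewrite u0 add0r.
move=> [c pE su] tv; exists c => //.
by apply: eq_coords (IHs _ su tv) => j; rewrite addrAC.
Qed.

Lemma coords_opp (J : finType) (y : J -> M) s (v : J -> A) :
  coords y s v -> coords y [seq (- p.1, p.2) | p <- s] (fun j => - v j).
Proof.
elim: s v => [|p s IHs] v /=; first by move=> v0 j; rewrite v0 oppr0.
move=> [c pE su]; exists c => //.
by apply: eq_coords (IHs _ su) => j; rewrite scalerN opprB opprK addrC.
Qed.

Lemma coords1 (J : finType) (y : J -> M) (c : J -> S) a m :
  m = \sum_j c j *: y j -> coords y [:: (a, m)] (fun j => sg (c j) *: a).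
Proof. by move=> mE; exists c => //= j; rewrite subrr. Qed.

Lemma coords_change (J K : finType) (y : J -> M) (w : K -> M) G s (v : J -> A) :
  (forall j, y j = \sum_k G j k *: w k) -> coords y s v ->
  coords w s (fun k => \sum_j sg (G j k) *: v j).
Proof.
move=> yE; elim: s v => [|p s IHs] v /=.
  by move=> v0 k; rewrite big1 // => j _; rewrite v0 scaler0.
move=> [c pE su]; exists (fun k => \sum_j c j * G j k).
  rewrite pE; under eq_bigr do rewrite yE scaler_sumr.
  rewrite exchange_big; apply: eq_bigr => k _; rewrite scaler_suml.
  by apply: eq_bigr => j _; rewrite scalerA.
apply: eq_coords (IHs _ su) => k /=.
rewrite sg_sum scaler_suml -sumrB; apply: eq_bigr => j _.
by rewrite scalerBr scalerA sgM.
Qed.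

Lemma expand_inl (J K : finType) (y : J -> M) (z : K -> M) j :
  y j = \sum_(k : J + K) (inl j == k)%:R *:
    (match k with inl j => y j | inr k => z k end).
Proof.
rewrite (bigD1 (inl j)) //= eqxx scale1r big1 ?addr0 // => k.
by rewrite eq_sym => /negPf->; rewrite scale0r.
Qed.

Lemma expand_inr (J K : finType) (y : J -> M) (z : K -> M) j :
  z j = \sum_(k : J + K) (inr j == k)%:R *:
    (match k with inl j => y j | inr k => z k end).
Proof.
rewrite (bigD1 (inr j)) //= eqxx scale1r big1 ?addr0 // => k.
by rewrite eq_sym => /negPf->; rewrite scale0r.
Qed.

Lemma coords_ex s : exists (J : finType) (y : J -> M) v, coords y s v.
Proof.
elim: s => [|[a m] s [J [y [v sv]]]].
  by exists void, (of_void M), (of_void A) => -[].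
have c1 : m = \sum_(j : unit) 1 *: m.
  by rewrite (big_pred1 tt) ?scale1r // => -[].
have cp := @coords1 unit (fun=> m) (fun=> 1) a m c1.
have hl := coords_change (expand_inl (fun=> m) y) cp.
have hr := coords_change (expand_inr (fun _ : unit => m) y) sv.
by do 3 eexists; apply: (coords_cat hl hr).
Qed.

Definition coords_sim s t :=
  exists (J : finType) (y : J -> M) v, coords y s v /\ coords y t v.

Lemma coords_eval (U : zmodType) (b : A -> M -> U) (J : finType) (y : J -> M) s v :
  tbalanced b -> coords y s v ->
  \sum_(p <- s) b p.1 p.2 = \sum_j b (v j) (y j).
Proof.
move=> hb; have [bD _ bZ] := hb; elim: s v => [|p s IHs] v /=.
  by move=> v0; rewrite big_nil big1 // => j _; rewrite v0 tbalanced0l.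
move=> [c pE sv]; rewrite big_cons (IHs _ sv) pE tbalanced_sumr //.
rewrite -big_split; apply: eq_bigr => j _ /=.
by rewrite -bZ -bD addrC subrK.
Qed.

Hypothesis hM : eqflat M.

(** Two coordinate vectors of one formal sum become equal along a suitable common family. This gives
    transitivity of [coords_sim], and it is where flatness of [M] enters. *)
Lemma coords_common s (J K : finType) (y : J -> M) (z : K -> M) u v :
  coords y s u -> coords z s v ->
  exists (L : finType) (w : L -> M) (G : J -> L -> S) (H : K -> L -> S),
    [/\ forall j, y j = \sum_l G j l *: w l, forall k, z k = \sum_l H k l *: w l
      & forall l, \sum_j sg (G j l) *: u j = \sum_k sg (H k l) *: v k].
Proof.
elim: s u v => [|p s IHs] u v /=.
  move=> u0 v0; exists (J + K)%type.
  exists (fun k => match k with inl j => y j | inr k => z k end).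
  exists (fun j k => (inl j == k)%:R), (fun j k => (inr j == k)%:R).
  split=> [j|j|l]; [exact: expand_inl | exact: expand_inr |].
  by rewrite !big1 // => j _; rewrite ?u0 ?v0 scaler0.
move=> [c pE su] [d pE' sv].
have [L [w [G [H [yE zE GH]]]]] := IHs _ _ su sv.
have comp (Q P : finType) (a : P -> S) (B : P -> Q -> S) (x : P -> M)
    (t : Q -> M) : (forall j, x j = \sum_l B j l *: t l) ->
    \sum_j a j *: x j = \sum_l (\sum_j a j * B j l) *: t l.
  move=> xE; under eq_bigr do rewrite xE scaler_sumr.
  rewrite exchange_big; apply: eq_bigr => l _; rewrite scaler_suml.
  by apply: eq_bigr => j _; rewrite scalerA.
(* The two expansions of [p.2] give a relation between the [w l]; rewriting these along a
   factorization [t] makes the contributions of [p.1] on both sides agree. *)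
have : \sum_l (\sum_j c j * G j l - \sum_k d k * H k l) *: w l = 0.
  under eq_bigr do rewrite scalerBl.
  by rewrite sumrB -(comp _ _ _ _ _ _ yE) -(comp _ _ _ _ _ _ zE) -pE -pE' subrr.
move=> /hM[Q [E [t [wE cE]]]].
exists Q, t, (fun j q => \sum_l G j l * E l q), (fun k q => \sum_l H k l * E l q).
split=> [j|k|q]; [by rewrite yE; apply: comp | by rewrite zE; apply: comp |].
have expand (P : finType) (B : P -> L -> S) (e : P -> S) (x : P -> A) :
    \sum_j sg (\sum_l B j l * E l q) *: x j =
    \sum_l sg (E l q) *: (\sum_j sg (B j l) *: (x j - sg (e j) *: p.1))
    + sg (\sum_l (\sum_j e j * B j l) * E l q) *: p.1.
  transitivity (\sum_l sg (E l q) *: (\sum_j sg (B j l) *: x j)).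
    under [RHS]eq_bigr do rewrite scaler_sumr.
    rewrite exchange_big; apply: eq_bigr => j _; rewrite sg_sum scaler_suml.
    by apply: eq_bigr => l _; rewrite scalerA sgM.
  rewrite sg_sum scaler_suml -big_split; apply: eq_bigr => l _ /=.
  rewrite sgM -scalerA -scalerDr; congr (_ *: _).
  rewrite sg_sum scaler_suml -big_split; apply: eq_bigr => j _ /=.
  by rewrite sgM -scalerA -scalerDr subrK.
rewrite (expand _ _ c) (expand _ _ d); congr (_ + _).
  by apply: eq_bigr => l _; rewrite GH.
congr (sg _ *: _); apply/eqP; rewrite -subr_eq0 -sumrB.
by under eq_bigr do rewrite -mulrBl; rewrite cE.
Qed.

Lemma coords_setoid : exists zs : zsetoid (seq (A * M)),
  [/\ zeq zs = coords_sim, zadd zs = cat & zzero zs = [::]].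
Proof.
have refl s : coords_sim s s.
  by have [J [y [v sv]]] := coords_ex s; exists J, y, v.
unshelve eexists (@ZSetoid _ coords_sim [::] cat
  (fun s => [seq (- p.1, p.2) | p <- s]) _ _ _ _ _ _ _ _ _) => //.
- by move=> s t [J [y [v [sv tv]]]]; exists J, y, v.
- move=> s t r [J [y [u [su tu]]]] [K [z [v [tv rv]]]].
  have [L [w [G [H [yE zE GH]]]]] := coords_common tu tv.
  exists L, w, (fun l => \sum_j sg (G j l) *: u j); split.
    exact: coords_change su.
  by apply: eq_coords (coords_change zE rv) => l; rewrite GH.
- move=> s s' t t' [J [y [u [su su']]]] [K [z [v [tv tv']]]].
  do 3 eexists; split.
    exact: coords_cat (coords_change (expand_inl y z) su)
      (coords_change (expand_inr y z) tv).
  exact: coords_cat (coords_change (expand_inl y z) su')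
    (coords_change (expand_inr y z) tv').
- move=> s t [J [y [v [sv tv]]]].
  by exists J, y, (fun j => - v j); split; apply: coords_opp.
- by move=> s t r; rewrite catA.
- move=> s t; have [J [y [u su]]] := coords_ex s.
  have [K [z [v tv]]] := coords_ex t.
  have hs := coords_change (expand_inl y z) su.
  have ht := coords_change (expand_inr y z) tv.
  do 3 eexists; split; first exact: coords_cat hs ht.
  by apply: eq_coords (coords_cat ht hs) => j; rewrite addrC.
- move=> s; have [J [y [v sv]]] := coords_ex s.
  exists J, y, (fun=> 0); split=> //.
  by apply: eq_coords (coords_cat (coords_opp sv) sv) => j; rewrite addNr.
Qed.

(** Formal sums modulo [coords_sim] form a group receiving a balanced map. The induced map on the
    tensor product sends the sum to the class of [s], which must therefore be zero. *)
Lemma ttensor_eq0 (U : zmodType) (b : A -> M -> U) s : ttensor b ->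
  \sum_(p <- s) b p.1 p.2 = 0 ->
  exists (J : finType) (y : J -> M), coords y s (fun=> 0).
Proof.
move=> [hb ub] s0; have [zs [eE aE zE]] := coords_setoid.
have [] := ub (zquot zs) (fun a m => zclass zs [:: (a, m)]).
  have c1 (m : M) : m = \sum_(j : unit) 1 *: m.
    by rewrite (big_pred1 tt) ?scale1r // => -[].
  have cu a m : coords (fun _ : unit => m) [:: (a, m)] (fun=> sg 1 *: a).
    exact: (@coords1 unit (fun=> m) (fun=> 1) a m (c1 m)).
  split=> [a a' m|a m m'|a r m]; rewrite -?zclassD; apply/zclass_eq;
      rewrite eE ?aE.
  - exists unit, (fun=> m), (fun j => sg 1 *: (a + a')); split.
      exact: cu.
    by rewrite scalerDr; apply: coords_cat (cu a m) (cu a' m).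
  - exists bool, (fun j : bool => if j then m else m').
    exists (fun j : bool => sg 1 *: a); split.
      apply: (@coords1 bool _ (fun=> 1)).
      by rewrite big_bool !scale1r.
    apply: eq_coords (@coords_cat _ _ [:: (a, m)] [:: (a, m')]
      (fun j : bool => sg (if j then 1 else 0) *: a)
      (fun j : bool => sg (if j then 0 else 1) *: a) _ _).
    + by case; rewrite sg0 scale0r ?addr0 ?add0r.
    + apply: (@coords1 bool _ (fun j : bool => if j then 1 else 0)).
      by rewrite big_bool /= scale1r scale0r addr0.
    + apply: (@coords1 bool _ (fun j : bool => if j then 0 else 1)).
      by rewrite big_bool /= scale1r scale0r add0r.
  - exists unit, (fun=> m), (fun=> sg 1 *: (sg r *: a)); split.
      exact: cu.
    apply: eq_coords (@coords1 unit (fun=> m) (fun=> r) _ _ _) => [_|].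
      by rewrite scalerA sg1 mul1r.
    by rewrite (big_pred1 tt) // => -[].
move=> g [gb _].
have : zclass zs s = zclass zs [::].
  transitivity (g (\sum_(p <- s) b p.1 p.2)); last first.
    by rewrite s0 raddf0 -zclass0 zE.
  rewrite raddf_sum; elim: s {s0} => [|p s IHs]; first by rewrite big_nil -zclass0 zE.
  by rewrite big_cons gb -IHs -zclassD aE -surjective_pairing.
move=> /zclass_eq; rewrite eE => -[J [y [v [sv v0]]]].
by exists J, y; apply: eq_coords sv.
Qed.

End Pair.

Definition tflat (M : lmodType S) : Prop :=
  forall (A B : lmodType T) (f : {linear A -> B}), injective f ->
  forall (U V : zmodType) (b : A -> M -> U) (c : B -> M -> V),
    ttensor b -> ttensor c ->
  forall g : {additive U -> V}, (forall a m, g (b a m) = c (f a) m) ->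
    injective g.

Lemma coords_map (A B : lmodType T) (M : lmodType S) (f : {linear A -> B})
    (J : finType) (y : J -> M) (s : seq (A * M)) v :
  coords y [seq (f p.1, p.2) | p <- s] v ->
  exists2 u, coords y s u & forall j, v j = f (u j).
Proof.
elim: s v => [|p s IHs] v /=.
  by move=> v0; exists (fun=> 0) => // j; rewrite v0 linear0.
move=> [c pE /IHs[u su uE]].
exists (fun j => u j + sg (c j) *: p.1).
  by exists c => //; apply: eq_coords su => j; rewrite addrK.
by move=> j; rewrite linearD linearZ /= -uE subrK.
Qed.

(** If an image under [g] vanishes, the zero coordinates witnessing this are values of [f] on
    coordinates over [A]; as [f] is injective, these vanish already. *)
Lemma eqflat_tflat (M : lmodType S) : eqflat M -> tflat M.
Proof.
move=> hM A B f fI U V b c tb tc g gE.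
suff g0 x : g x = 0 -> x = 0.
  move=> x y xy; apply/eqP; rewrite -subr_eq0; apply/eqP/g0.
  by rewrite raddfB xy subrr.
have [s ->] := ttensor_gen x tb; rewrite raddf_sum.
under eq_bigr do rewrite gE.
rewrite -(big_map (fun p => (f p.1, p.2)) xpredT (fun p => c p.1 p.2)).
move=> /(ttensor_eq0 hM tc)[J [y /coords_map[u su u0]]].
have [hb _] := tb; rewrite (coords_eval hb su) big1 // => j _.
have -> : u j = 0 by apply: fI; rewrite -u0 linear0.
exact: tbalanced0l.
Qed.

Hypothesis tensors_exist : forall (A : lmodType T) (M : lmodType S),
  exists (U : zmodType) (b : A -> M -> U), ttensor b.

(** Let [J] be the ideal generated by the [sg (r i)]. The sum of the tensors of [k i] with [x i]
    dies in the tensor product of [T^o] with [M], hence already in that of [J]. Sending the tensor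
    of [sg (\sum_i r i * d i)] with [m] to the family [d i *: m], modulo factored families, then
    shows that [x] is factored. *)
Lemma tflat_eqflat (M : lmodType S) : tflat M -> eqflat M.
Proof.
move=> hM I r x rx.
pose P (t : T^o) := exists c : I -> S, t = sg (\sum_i r i * c i).
have Psub : submodule P.
  split=> [|_ _ [c ->] [d ->]|t _ [c ->]].
  - exists (fun=> 0); rewrite big1 ?sg0 // => i _; exact: mulr0.
  - exists (fun i => c i + d i); rewrite -sgD -big_split.
    by congr sg; apply: eq_bigr => i _; rewrite mulrDr.
  - have [w <-] := sg_surj t; exists (fun i => c i * w).
    rewrite /GRing.scale /= -sgM mulr_suml.
    by congr sg; apply: eq_bigr => i _; rewrite mulrA.
have [J [j [jI jP]]] := submodule_mk Psub.
have [U [b tb]] := tensors_exist J M; have [V [c tc]] := tensors_exist T^o M.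
have [hb ub] := tb; have [hc _] := tc; have [cD cD' cZ] := hc.
have [] := ub V (fun a m => c (j a) m).
  by split=> *; rewrite ?linearD ?linearZ /= ?cD ?cD' ?cZ.
move=> g [gE _]; have gI := hM _ _ j jI _ _ _ _ tb tc g gE.
have /choice[k kE] i : exists k, j k = sg (r i).
  apply/jP; exists (fun l => (l == i)%:R); congr sg.
  rewrite (bigD1 i) //= eqxx mulr1 big1 ?addr0 // => l /negPf->.
  by rewrite mulr0.
have kx : \sum_i b (k i) (x i) = 0.
  apply: gI; rewrite raddf_sum raddf0 -[RHS](tbalanced0r (1 : T^o) hc) -rx.
  rewrite tbalanced_sumr //; apply: eq_bigr => i _.
  by rewrite gE kE -cZ; congr (c _ _); rewrite /GRing.scale /= mulr1.
have [zs [eE aE zE]] : exists zs : zsetoid (I -> M),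
    [/\ zeq zs = (fun u v => factors r (fun i => u i - v i)),
        zadd zs = (fun u v i => u i + v i) & zzero zs = fun=> 0].
  unshelve eexists (@ZSetoid (I -> M) (fun u v => factors r (fun i => u i - v i))
    (fun=> 0) (fun u v i => u i + v i) (fun u i => - u i) _ _ _ _ _ _ _ _ _) => //=.
  - by move=> u; apply: eq_factors (factors0 _ _) => i; rewrite subrr.
  - by move=> u v uv; apply: eq_factors (factorsN uv) => i; rewrite opprB.
  - move=> u v w uv vw; apply: eq_factors (factorsD uv vw) => i.
    by rewrite addrA subrK.
  - move=> u u' v v' uu vv; apply: eq_factors (factorsD uu vv) => i.
    by rewrite opprD addrACA.
  - by move=> u u' uu; apply: eq_factors (factorsN uu) => i; rewrite opprD.
  - by move=> u v w; apply: eq_factors (factors0 _ _) => i; rewrite addrA subrr.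
  - by move=> u v; apply: eq_factors (factors0 _ _) => i; rewrite (addrC (v i)) subrr.
  - by move=> u; apply: eq_factors (factors0 _ _) => i; rewrite add0r subrr.
  - by move=> u; apply: eq_factors (factors0 _ _) => i; rewrite addNr subrr.
have clsE (d d' : I -> S) m : sg (\sum_i r i * d i) = sg (\sum_i r i * d' i) ->
    zclass zs (fun i => d i *: m) = zclass zs (fun i => d' i *: m).
  move=> /sg_inj dd; apply/zclass_eq; rewrite eE.
  have : factors r (fun i => (d i - d' i) *: m).
    apply: factors1; under eq_bigr do rewrite mulrBr.
    by rewrite sumrB dd subrr.
  by apply: eq_factors => i; rewrite scalerBl.
have /choice[co coE] a : exists d : I -> S, j a = sg (\sum_i r i * d i).
  by apply/jP; exists a.
have [] := ub (zquot zs) (fun a m => zclass zs (fun i => co a i *: m)).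
  split=> [a a' m|a m m'|a t m].
  - rewrite -zclassD aE -[RHS](_ : zclass zs (fun i => (co a i + co a' i) *: m) = _).
      apply: clsE; rewrite -coE linearD /= !coE -sgD -big_split.
      by congr sg; apply: eq_bigr => i _; rewrite mulrDr.
    by congr zclass; apply/funext => i; rewrite scalerDl.
  - by rewrite -zclassD aE; congr zclass; apply/funext => i; rewrite scalerDr.
  - rewrite -[RHS](_ : zclass zs (fun i => (co a i * t) *: m) = _).
      apply: clsE; rewrite -coE linearZ /= coE /GRing.scale /= -sgM mulr_suml.
      by congr sg; apply: eq_bigr => i _; rewrite mulrA.
    by congr zclass; apply/funext => i; rewrite scalerA.
move=> h [hE _].
have : zclass zs x = zclass zs (fun=> 0).
  have -> : zclass zs (fun=> 0) = h (\sum_i b (k i) (x i)).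
    by rewrite kx raddf0 -zE.
  rewrite raddf_sum.
  under eq_bigr => i _.
    rewrite hE (clsE _ (fun l => (l == i)%:R)); last first.
      rewrite -coE kE; congr sg.
      rewrite (bigD1 i) //= eqxx mulr1 big1 ?addr0 // => l /negPf->.
      by rewrite mulr0.
    over.
  have sumE (s : seq I) (F : I -> I -> M) :
      \sum_(i <- s) zclass zs (F i) = zclass zs (fun l => \sum_(i <- s) F i l).
    elim: s => [|i s IHs].
      rewrite big_nil -zclass0 zE; congr zclass.
      by apply/funext => l; rewrite big_nil.
    rewrite big_cons IHs -zclassD aE; congr zclass.
    by apply/funext => l; rewrite big_cons.
  rewrite sumE; congr zclass; apply/funext => l.
  rewrite (bigD1 l) //= eqxx scale1r big1 ?addr0 // => i.
  by rewrite eq_sym => /negPf->; rewrite scale0r.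
move=> /zclass_eq; rewrite eE; apply: eq_factors => i; exact: subr0.
Qed.

End Tensors.

Lemma left_flatE (R : pzRingType) : @left_flat R = @eqflat R.
Proof.
pose sg (r : R) : R^c := r.
apply/funext => M; apply/propext; split=> hM.
  apply: (@tflat_eqflat R R^c sg) => //; first by move=> t; exists t.
  exact: tensor_exists.
exact: (@eqflat_tflat R R^c sg).
Qed.

Lemma right_flatE (R : pzRingType) : @right_flat R = @eqflat R^c.
Proof.
pose sg (r : R^c) : R := r.
have balE (A : lmodType R^c) (M : lmodType R) (U : zmodType) (b : A -> M -> U) :
    balanced b <-> tbalanced sg (fun m a => b a m).
  by split=> -[h1 h2 h3]; split=> // *; rewrite -?h3 ?h3.
have tenE (A : lmodType R^c) (M : lmodType R) (U : zmodType) (b : A -> M -> U) :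
    is_tensor b <-> ttensor sg (fun m a => b a m).
  split=> -[hb ub]; split; try exact/balE.
    move=> V c hc; have [|g [gE gU]] := ub V (fun a m => c m a); first exact/balE.
    by exists g; split=> // h hE; apply: gU.
  move=> V c /balE hc; have [g [gE gU]] := ub V _ hc.
  by exists g; split=> // h hE; apply: gU.
have flatE (A : lmodType R^c) : right_flat A <-> tflat sg A.
  split=> hA M N f fI U V b c.
    move=> tb tc g gE; apply: (hA M N f fI U V (fun a m => b m a) (fun a m => c m a)).
    - exact/tenE.
    - exact/tenE.
    - by move=> a m; apply: gE.
  move=> /tenE tb /tenE tc g gE; apply: (hA M N f fI U V _ _ tb tc).
  by move=> m a; apply: gE.
apply/funext => A; apply/propext; rewrite flatE; split=> hA.
  apply: (@tflat_eqflat R^c R sg) => //; first by move=> t; exists t.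
  move=> M B; have [U [b /tenE tb]] := tensor_exists B M.
  by exists U, (fun m a => b a m).
exact: (@eqflat_tflat R^c R sg).
Qed.

(** * Closure properties of completing domains *)

Lemma eqflat_completing (S : pzRingType) (M N : lmodType S) :
  eqflat N -> precover_completing_domain (@eqflat S) M N.
Proof.
move=> hN f F g [_ gP]; have [h hE] := gP N hN idfun.
by exists (h \o f : {linear _ -> _}) => x /=; rewrite hE.
Qed.

Lemma completing_eqflat (S : pzRingType) (N : lmodType S) :
  precover_completing_domain (@eqflat S) N N -> eqflat N.
Proof.
move=> hN; have [F [g gP]] := flat_precover_exists N.
have [h hE] := hN idfun F g gP; have [hF _] := gP.
exact: eqflat_retract hE hF.
Qed.

Definition flat_products (S : pzRingType) : Prop :=
  forall (I : Type) (F : I -> lmodType S),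
    (forall i, eqflat (F i)) -> eqflat (dirprod F : lmodType S).

Definition flat_submodules (S : pzRingType) : Prop :=
  forall (F K : lmodType S) (i : {linear K -> F}),
    injective i -> eqflat F -> eqflat K.

(** Each [y] is the image of 1 under a map from the flat regular module, and this map lifts. *)
Lemma flat_precover_surj (S : pzRingType) (F N : lmodType S)
    (g : {linear F -> N}) : precover (@eqflat S) g -> surjective g.
Proof.
move=> [_ gP] y.
have fL : linear (fun r : S^o => (r : S) *: y).
  by move=> r u v; rewrite scalerDl scalerA.
have [f fE] := linear_mk fL; have [h hE] := gP _ (@eqflat_regular S) f.
by exists (h 1); rewrite hE fE scale1r.
Qed.

(** Given a precover [g] of the product, each component of [f] lifts to [F]. The lifts together land
    in a power of [F], which is flat, so the evident map from this power to the product factors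
    through [g]. *)
Lemma flat_productsP (S : pzRingType) :
  flat_products S <-> forall M : lmodType S,
    closed_under_products (precover_completing_domain (@eqflat S) M).
Proof.
split=> [prodS M I N hN f F g [hF gP]|closed I F hF]; last first.
  by apply/completing_eqflat/closed => i; apply: eqflat_completing.
have prL i : linear (fun u : dirprod N => u i) by [].
have /choice[h hE] i : exists h : {linear M -> F}, forall x, g (h x) i = f x i.
  have [pr prE] := linear_mk (prL i).
  (* A component of a flat precover of a product is a flat precover: extend   *)
  (* maps into that component by zero.                                        *)
  have pgP : precover (@eqflat S) (pr \o g : {linear F -> N i}).
    split=> // F' hF' k.
    have kL : linear (fun x => (fun j => delta N i j (k x)) : dirprod N).
      by move=> r x y; apply: functional_extensionality_dep => j; rewrite !linearP.
    have [k' k'E] := linear_mk kL; have [h hE] := gP F' hF' k'.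
    by exists h => x /=; rewrite hE k'E prE delta_same.
  have [h hE] := hN i (pr \o f : {linear M -> N i}) F _ pgP.
  by exists h => x; have := hE x; rewrite /= !prE.
have hF' : eqflat (dirprod (fun _ : I => F) : lmodType S) by apply: prodS.
have kL : linear (fun u : dirprod (fun _ : I => F) =>
    (fun i => g (u i) i) : dirprod N).
  move=> r u v; apply: functional_extensionality_dep => i.
  by change (g (r *: u i + v i) i = (r *: g (u i) + g (v i)) i); rewrite linearP.
have [k kE] := linear_mk kL; have [l lE] := gP _ hF' k.
have hL : linear (fun x => (fun i => h i x) : dirprod (fun _ : I => F)).
  by move=> r x y; apply: functional_extensionality_dep => i; rewrite linearP.
have [h' h'E] := linear_mk hL.
exists (l \o h' : {linear _ -> _}) => x /=.
by rewrite lE kE h'E; apply: functional_extensionality_dep => i; rewrite hE.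
Qed.

(** With [q] a flat precover of [N], the lift of [i \o f] lands in the preimage [L] of [K]. This [L]
    is flat as a submodule, so its map to [K] factors through [g]. *)
Lemma flat_submodulesP (S : pzRingType) :
  flat_submodules S <-> forall M : lmodType S,
    closed_under_submodules (precover_completing_domain (@eqflat S) M).
Proof.
split=> [subS M N K i iI hN f F g [hF gP]|closed F K i iI hF]; last first.
  by apply/completing_eqflat/(closed _ _ _ i iI); apply: eqflat_completing.
have [G [q qP]] := flat_precover_exists N; have [hG _] := qP.
have [h hE] := hN (i \o f : {linear _ -> _}) G q qP.
pose P x := exists k, i k = q x.
have Psub : submodule P.
  split=> [|x y [k kx] [l ly]|r x [k kx]].
  - by exists 0; rewrite !linear0.
  - by exists (k + l); rewrite !linearD kx ly.
  - by exists (r *: k); rewrite !linearZ /= kx.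
have [L [j [jI jP]]] := submodule_mk Psub.
have hL : eqflat L by apply: subS jI hG.
have /choice[p pE] x : exists k, i k = q (j x) by apply/jP; exists x.
have pL : linear p by move=> r x y; apply: iI; rewrite linearP !pE !linearP.
have [p' p'E] := linear_mk pL; have [l lE] := gP _ hL p'.
have /choice[m mE] x : exists y, j y = h x.
  by apply/jP; exists (f x); rewrite hE.
have mL : linear m by move=> r x y; apply: jI; rewrite linearP !mE linearP.
have [m' m'E] := linear_mk mL.
exists (l \o m' : {linear _ -> _}) => x /=.
by apply: iI; rewrite lE p'E pE m'E mE hE.
Qed.

(** * Coherence, weak dimension and semiheredity *)

(** The coefficients [d j] act on the right: the right module of relations between finitely many
    ring elements is finitely generated. Over [R^c] this becomes the left-handed condition on
    [R]. *)
Definition relations_fg (S : pzRingType) : Prop :=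
  forall n (r : 'I_n -> S), exists m (k : 'I_m -> 'I_n -> S),
    (forall j, \sum_i r i * k j i = 0) /\
    forall c, \sum_i r i * c i = 0 ->
      exists d, forall i, c i = \sum_j k j i * d j.

Lemma dirprod_sum (S : pzRingType) (I : Type) (F : I -> lmodType S) (T : Type)
    (s : seq T) (u : T -> dirprod F) i :
  (\sum_(t <- s) u t) i = \sum_(t <- s) u t i.
Proof. exact: (big_morph (fun v : dirprod F => v i)). Qed.

(** Forward, take the power of [S^o] indexed by all relations [c] and the tautological relation
    whose entries at [c] are the [c i]; its factorization has finitely many coefficient columns,
    which generate. Backward, the same generators solve the relation in every coordinate at once. *)
Lemma flat_products_relations_fg (S : pzRingType) :
  flat_products S <-> relations_fg S.
Proof.
split=> [prodS n r|rel I F hF].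
  pose I := {c : 'I_n -> S | \sum_i r i * c i = 0}.
  have := prodS I (fun=> S^o) (fun=> @eqflat_regular S).
  move=> /(_ _ r (fun i => (fun c : I => sval c i) : dirprod (fun _ : I => S^o))).
  case=> [|J [a [y [xE ra]]]].
    apply: functional_extensionality_dep => c; rewrite dirprod_sum.
    exact: (proj2_sig c).
  exists #|J|, (fun j i => a i (enum_val j)); split=> // c rc.
  exists (fun j => y (enum_val j) (exist _ c rc)) => i.
  have /(congr1 (fun u => u (exist _ c rc))) := xE i.
  by rewrite dirprod_sum /= => ->; apply: sum_enum_val.
apply: eqflat_ord => n r x rx; have [m [k [rk kP]]] := rel n r.
have zP t : exists z : 'I_m -> F t,
    forall i, x i t = \sum_j k j i *: z j.
  have /hF[J [a [y [xE ra]]]] : \sum_i r i *: x i t = 0.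
    by rewrite -[RHS](congr1 (fun u => u t) rx) dirprod_sum.
  have /choice[d dE] j := kP (fun i => a i j) (ra j).
  exists (fun l => \sum_j d j l *: y j) => i; rewrite xE.
  under eq_bigr do rewrite dE scaler_suml.
  rewrite exchange_big; apply: eq_bigr => l _; rewrite scaler_sumr.
  by apply: eq_bigr => j _; rewrite scalerA.
pose z t := projT1 (cid (zP t)).
have zE t i : x i t = \sum_j k j i *: z t j by rewrite /z; case: cid.
exists 'I_m, (fun i j => k j i), (fun j => (fun t => z t j) : dirprod F).
split=> // i; apply: functional_extensionality_dep => t.
by rewrite dirprod_sum zE.
Qed.

(** * Generators and relations in terms of row vectors *)

Section LinearCombinations.
Variable S : pzRingType.

Definition lincomb (M : lmodType S) n (x : 'I_n -> M) (c : 'rV[S]_n) : M :=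
  \sum_i c 0 i *: x i.

Lemma lincomb_linear (M : lmodType S) n (x : 'I_n -> M) : linear (lincomb x).
Proof.
move=> r c d; rewrite /lincomb scaler_sumr -big_split; apply: eq_bigr => i _ /=.
by rewrite !mxE scalerDl scalerA.
Qed.

Lemma lincombE (M N : lmodType S) n (x : 'I_n -> M) (f : {linear M -> N}) c :
  f (lincomb x c) = lincomb (fun i => f (x i)) c.
Proof. by rewrite linear_sum; apply: eq_bigr => i _; rewrite linearZ. Qed.

Lemma lincomb_mulmx (M : lmodType S) m n (x : 'I_n -> M) (d : 'rV[S]_m)
    (K : 'M[S]_(m, n)) :
  lincomb x (d *m K) = lincomb (fun j => lincomb x (row j K)) d.
Proof.
rewrite /lincomb.
under eq_bigr do rewrite mxE scaler_suml.
rewrite exchange_big; apply: eq_bigr => j _; rewrite scaler_sumr.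
by apply: eq_bigr => i _; rewrite scalerA mxE.
Qed.

Lemma lincomb_col n (r : 'I_n -> S^o) (c : 'rV[S]_n) :
  lincomb r c = (c *m \col_i (r i : S)) 0 0.
Proof. by rewrite mxE; apply: eq_bigr => i _; rewrite mxE. Qed.

Lemma linear_lincomb (M : lmodType S) n (f : {linear 'rV[S]_n -> M}) c :
  f c = lincomb (fun i => f (delta_mx 0 i)) c.
Proof. by rewrite [in LHS](row_sum_delta c) -lincombE. Qed.

Lemma lincomb_submodule (M : lmodType S) n (x : 'I_n -> M) :
  submodule (fun y => exists c, y = lincomb x c).
Proof.
have [f fE] := linear_mk (lincomb_linear x).
split=> [|_ _ [c ->] [d ->]|r _ [c ->]].
- by exists 0; rewrite -fE linear0.
- by exists (c + d); rewrite -!fE linearD.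
- by exists (r *: c); rewrite -!fE linearZ.
Qed.

Lemma span_mk (M : lmodType S) n (x : 'I_n -> M) :
  exists (J : lmodType S) (i : {linear J -> M}) (u : 'I_n -> J),
    [/\ injective i, forall k, i (u k) = x k
      & forall y, exists c, y = lincomb u c].
Proof.
have [J [i [iI iP]]] := submodule_mk (lincomb_submodule x).
have /choice[u uE] k : exists y, i y = x k.
  apply/iP; exists (delta_mx 0 k); rewrite /lincomb (bigD1 k) //= mxE !eqxx.
  rewrite scale1r big1 ?addr0 // => l /negPf lk.
  by rewrite mxE eqxx lk scale0r.
exists J, i, u; split=> // y; have [c yE] : exists c, i y = lincomb x c.
  by apply/iP; exists y.
exists c; apply: iI; rewrite lincombE yE.
by apply: eq_bigr => k _; rewrite uE.
Qed.

Lemma lincomb_fg (M : lmodType S) n (x : 'I_n -> M) :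
  (forall y, exists c, y = lincomb x c) -> finitely_generated M.
Proof.
by move=> gen; exists n, x => y; have [c ->] := gen y; exists (fun i => c 0 i).
Qed.

Lemma fg_lincomb (M : lmodType S) : finitely_generated M ->
  exists n (x : 'I_n -> M), forall y, exists c, y = lincomb x c.
Proof.
move=> [n [x gen]]; exists n, x => y; have [c ->] := gen y.
by exists (\row_i c i); apply: eq_bigr => i _; rewrite mxE.
Qed.

Definition fg_relations (M : lmodType S) n (x : 'I_n -> M) : Prop :=
  exists m (K : 'M[S]_(m, n)), forall c, lincomb x c = 0 <-> exists d, c = d *m K.

(** A finite presentation on one generating family yields finitely many relations for any other, as
    in Schanuel's lemma. *)
Lemma fp_fg_relations (M : lmodType S) n (x : 'I_n -> M) :
  finitely_presented M -> (forall y, exists c, y = lincomb x c) ->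
  fg_relations x.
Proof.
move=> [m [p [f [g [gS fg]]]]] gen.
have [u uE] := choice (fun i => gS (x i)).
have [v vE] := choice (fun j => gen (g (delta_mx 0 j))).
pose U := \matrix_i u i; pose V := \matrix_j v j.
pose D := \matrix_l f (delta_mx 0 l).
have gE a : g a = lincomb x (a *m V).
  rewrite linear_lincomb lincomb_mulmx; apply: eq_bigr => j _.
  by rewrite vE rowK.
have xE c : lincomb x c = g (c *m U).
  rewrite mulmx_sum_row linear_sum; apply: eq_bigr => i _.
  by rewrite linearZ rowK uE.
have fE w : f w = w *m D.
  rewrite mulmx_sum_row linear_lincomb; apply: eq_bigr => i _.
  by rewrite rowK.
have [h hE] := linear_mk (lincomb_linear x).
(* [U] and [V] translate between the two generating families. A relation [c] is
   [c *m (1%:M - U *m V) + c *m U *m V], and [c *m U], being in the kernel of [g], is of the form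
   [w *m D]. *)
exists (n + m)%N, (col_mx (1%:M - U *m V) (D *m V)) => c; split=> [c0|[d ->]].
  have /fg[w wE] : g (c *m U) = 0 by rewrite -xE.
  exists (row_mx c w); rewrite mul_row_col mulmxBr mulmx1 !mulmxA -wE fE.
  by rewrite subrK.
rewrite -[d]hsubmxK mul_row_col mulmxBr mulmx1 !mulmxA -hE linearD linearB /= !hE.
rewrite -!gE -xE subrr add0r; apply/fg; exists (rsubmx d); exact: fE.
Qed.

Lemma fg_relations_fp (M : lmodType S) n (x : 'I_n -> M) :
  (forall y, exists c, y = lincomb x c) -> fg_relations x ->
  finitely_presented M.
Proof.
move=> gen [m [K KP]].
have KL : linear (fun d : 'rV[S]_m => d *m K).
  by move=> r c d; rewrite mulmxDl scalemxAl.
have [f fE] := linear_mk KL; have [g gE] := linear_mk (lincomb_linear x).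
exists m, n, f, g; split=> [y|c].
  by have [c ->] := gen y; exists c; rewrite gE.
rewrite gE KP.
by split=> -[d dE]; exists d; [rewrite fE dE | rewrite -dE fE].
Qed.

End LinearCombinations.

(** In [R^c^o] the combination [lincomb r c] is [\sum_i r i * c i] computed in [R], so both sides
    speak of the relations between generators of a right ideal. *)
Lemma right_coherentP (R : pzRingType) : right_coherent R <-> relations_fg R.
Proof.
have relE n (r : 'I_n -> R^c^o) : fg_relations r <->
    exists m (k : 'I_m -> 'I_n -> R),
    (forall j, \sum_i (r i : R) * k j i = 0) /\
    forall c, \sum_i (r i : R) * c i = 0 ->
      exists d, forall i, c i = \sum_j k j i * d j.
  split=> [[m [K KP]]|[m [k [rk kP]]]].
    exists m, (fun j i => K j i); split=> [j|c rc].
      have /KP : exists d : 'rV_m, row j K = d *m K.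
        by exists (delta_mx 0 j); rewrite -rowE.
      by rewrite /lincomb; under eq_bigr do rewrite mxE.
    have /KP[d dE] : lincomb r (\row_i (c i : R^c)) = 0.
      by rewrite -[RHS]rc; apply: eq_bigr => i _; rewrite mxE.
    exists (fun j => d 0 j) => i.
    by have /rowP/(_ i) := dE; rewrite !mxE.
  exists m, (\matrix_(j, i) (k j i : R^c)) => c; split=> [rc|[d ->]].
    have [d dE] := kP (fun i => c 0 i) rc.
    exists (\row_j (d j : R^c)); apply/rowP => i; rewrite mxE dE.
    by apply: eq_bigr => j _; rewrite !mxE.
  rewrite lincomb_mulmx /lincomb big1 // => j _.
  rewrite (_ : \sum_i _ = 0) ?scaler0 //.
  by rewrite -[RHS](rk j); apply: eq_bigr => i _; rewrite !mxE.
split=> [coh n r|rel J i iI /fg_lincomb[n [x gen]]].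
  have [J [i [u [iI uE gen]]]] := span_mk (r : 'I_n -> R^c^o).
  have /fp_fg_relations/(_ gen)[m [K KP]] := coh J i iI (lincomb_fg gen).
  apply/relE; exists m, K => c; rewrite -KP.
  have -> : lincomb (r : 'I_n -> R^c^o) c = i (lincomb u c).
    by rewrite lincombE; apply: eq_bigr => k _; rewrite uE.
  by split=> [c0|->]; [apply: iI; rewrite linear0 | rewrite linear0].
apply: (fg_relations_fp gen).
have /relE[m [K KP]] := rel n (fun k => i (x k)).
exists m, K => c; rewrite -KP -lincombE.
by split=> [->|c0]; [rewrite linear0 | apply: iI; rewrite linear0].
Qed.

(** The pullback [B] of [e] and [q] is an extension of [F] by [F1], hence flat; [K] is the kernel of
    its surjection onto [F0]. This takes the place of a long exact sequence for Tor. *)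
Lemma pullback_eqflat (S : pzRingType) (K F Q F0 F1 : lmodType S)
    (i : {linear K -> F}) (q : {linear F -> Q})
    (d : {linear F1 -> F0}) (e : {linear F0 -> Q}) :
  injective i -> surjective q -> exact_at i q ->
  injective d -> surjective e -> exact_at d e ->
  eqflat F -> eqflat F0 -> eqflat F1 -> eqflat K.
Proof.
move=> iI qS iq dI eS de hF hF0 hF1.
pose P (x : F0 * F) := e x.1 = q x.2.
have Psub : submodule P.
  split=> [|x y|r x]; rewrite /P /= ?linear0 //.
  - by move=> xE yE; rewrite !linearD xE yE.
  - by move=> xE; rewrite !linearZ /= xE.
have [B [j [jI jP]]] := submodule_mk Psub.
have Pj b : e (j b).1 = q (j b).2 by apply/jP; exists b.
have p1L : linear (fun b => (j b).1) by move=> r x y; rewrite linearP.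
have p2L : linear (fun b => (j b).2) by move=> r x y; rewrite linearP.
have [p1 p1E] := linear_mk p1L; have [p2 p2E] := linear_mk p2L.
have /choice[a aE] x : exists b, j b = (d x, 0).
  by apply/jP; rewrite /P /= linear0; apply/de; exists x.
have /choice[k kE] x : exists b, j b = (0, i x).
  by apply/jP; rewrite /P /= linear0; apply/esym/iq; exists x.
have aL : linear a.
  move=> r x y; apply: jI; rewrite linearP !aE linearP /=.
  by congr pair; rewrite /= scaler0 addr0.
have kL : linear k.
  move=> r x y; apply: jI; rewrite linearP !kE linearP /=.
  by congr pair; rewrite /= scaler0 addr0.
have [a' a'E] := linear_mk aL; have [k' k'E] := linear_mk kL.
have hB : eqflat B.
  apply: (@eqflat_extension _ _ _ _ a' p2) => // [x y|y|b].
  - by rewrite !a'E => /(congr1 j); rewrite !aE => -[/dI].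
  - have [x xE] := eS (q y).
    have [b bE] : exists b, j b = (x, y) by apply/jP.
    by exists b; rewrite p2E bE.
  - rewrite p2E; split=> [b0|[x <-]]; last by rewrite a'E aE.
    have /de[x xE] : e (j b).1 = 0 by rewrite Pj b0 linear0.
    by exists x; apply: jI; rewrite a'E aE xE -b0 -surjective_pairing.
apply: (@eqflat_kernel _ _ _ _ k' p1) => // [x y|x|b].
- by rewrite !k'E => /(congr1 j); rewrite !kE => -[/iI].
- have [y yE] := qS (e x).
  have [b bE] : exists b, j b = (x, y) by apply/jP.
  by exists b; rewrite p1E bE.
- rewrite p1E; split=> [b0|[x <-]]; last by rewrite k'E kE.
  have /iq[x xE] : q (j b).2 = 0 by rewrite -Pj b0 linear0.
  by exists x; apply: jI; rewrite k'E kE xE -b0 -surjective_pairing.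
Qed.

Lemma wdim_le1P (R : pzRingType) : wdim_le R 1 <-> flat_submodules R.
Proof.
rewrite /wdim_le /flat_dim_le left_flatE.
split=> [wd F K i iI hF|subR M].
  pose P y := exists x, i x = y.
  have Psub : submodule P.
    split=> [|_ _ [x <-] [y <-]|r _ [x <-]].
    - by exists 0; rewrite linear0.
    - by exists (x + y); rewrite linearD.
    - by exists (r *: x); rewrite linearZ.
  have [Q [q [qS qP]]] := quotient_mk Psub.
  have [G [d [e [hG G0 eS de dd]]]] := wd Q.
  (* [G 2] is zero, so exactness at [G 1] leaves [d 0] no kernel. *)
  have dI : injective (d 0%N).
    move=> x y xy; apply/eqP; rewrite -subr_eq0.
    have /dd[z <-] : d 0%N (x - y) = 0 by rewrite linearB /= xy subrr.
    by rewrite (G0 2%N isT z) linear0.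
  exact: (pullback_eqflat iI qS qP dI eS de).
have [F [g gP]] := flat_precover_exists M; have [hF _] := gP.
have Ksub : submodule (fun x => g x = 0).
  split=> [|x y gx gy|r x gx]; first exact: linear0.
  - by rewrite linearD gx gy addr0.
  - by rewrite linearZ /= gx scaler0.
have [K [i [iI iP]]] := submodule_mk Ksub.
pose Z : lmodType R := 'rV[R]_0.
have Z0 (x y : Z) : x = y by rewrite (thinmx0 x) (thinmx0 y).
(* The zero map embeds the zero module in the flat module [F]. *)
have hZ : eqflat Z by apply: (subR F Z \0) => // x y _.
pose G n : lmodType R := match n with 0 => F | 1 => K | _ => Z end.
pose d n : {linear G n.+1 -> G n} :=
  match n return {linear G n.+1 -> G n} with 0 => i | _ => \0 end.
exists G, d, (g : {linear G 0%N -> M}); split.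
- by move=> [|[|n]] //=; apply: subR iI hF.
- by move=> [|[|n]] //= _ x; apply: Z0.
- exact: flat_precover_surj gP.
- exact: iP.
- case=> [|n] y /=; split=> [y0|[x xy]] //.
    by exists 0; apply: iI; rewrite y0 linear0.
  by rewrite -xy linear0.
Qed.

(** * Flat submodules and projective ideals in terms of matrices *)

Definition annihilator_split (S : pzRingType) : Prop :=
  forall n (c : 'rV[S]_n) (r : 'cV[S]_n), c *m r = 0 ->
    exists2 E : 'M[S]_n, E *m r = r & c *m E = 0.

Lemma mulmx_col (S : pzRingType) m n p (A : 'M[S]_(m, n)) (B : 'M[S]_(n, p)) l :
  col l (A *m B) = A *m col l B.
Proof. by rewrite !colE mulmxA. Qed.

(** Passing to [D = 1%:M - E] swaps the roles of row and column: [D] fixes [c] and kills the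
    columns. The columns can then be killed one after the other by multiplying such matrices. *)
Lemma annihilator_split_cols (S : pzRingType) n p (c : 'rV[S]_n)
    (A : 'M[S]_(n, p)) :
  annihilator_split S -> c *m A = 0 ->
  exists2 E : 'M[S]_n, E *m A = A & c *m E = 0.
Proof.
move=> spl cA.
suff [D Dc DA] : exists2 D : 'M[S]_n, c *m D = c
    & forall l, l \in enum 'I_p -> D *m col l A = 0.
  exists (1%:M - D); last by rewrite mulmxBr mulmx1 Dc subrr.
  rewrite mulmxBl mul1mx [D *m A](_ : _ = 0) ?subr0 //.
  apply/matrixP => i l; have := DA l; rewrite mem_enum -mulmx_col => /(_ isT).
  by move=> /colP/(_ i); rewrite mxE => ->; rewrite !mxE.
elim: (enum 'I_p) => [|l s [D Dc DA]]; first by exists 1%:M; rewrite ?mulmx1.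
have : c *m (D *m col l A) = 0.
  by rewrite mulmxA Dc -mulmx_col cA; apply/colP => i; rewrite !mxE.
move=> /spl[E EA cE]; exists ((1%:M - E) *m D).
  by rewrite mulmxA mulmxBr mulmx1 cE subr0.
move=> k; rewrite inE -mulmxA => /orP[/eqP->|ks].
  by rewrite mulmxBl mul1mx EA subrr.
by rewrite DA ?mulmx0.
Qed.

Lemma annihilator_split_rows (S : pzRingType) m n (K : 'M[S]_(m, n))
    (r : 'cV[S]_n) :
  annihilator_split S -> K *m r = 0 ->
  exists2 E : 'M[S]_n, E *m r = r & K *m E = 0.
Proof.
move=> spl Kr.
suff [E Er KE] : exists2 E : 'M[S]_n, E *m r = r
    & forall l, l \in enum 'I_m -> row l K *m E = 0.
  exists E => //; apply/row_matrixP => l.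
  by rewrite row_mul KE ?mem_enum // row0.
elim: (enum 'I_m) => [|l s [E Er KE]]; first by exists 1%:M; rewrite ?mul1mx.
have : row l K *m E *m r = 0 by rewrite -mulmxA Er -row_mul Kr row0.
move=> /spl[D Dr KD]; exists (E *m D); first by rewrite -mulmxA Dr.
move=> k; rewrite inE mulmxA => /orP[/eqP->|ks] //.
by rewrite KE // mul0mx.
Qed.

(** Forward, factor the relation in the ideal spanned by the entries of [r], and rewrite the new
    elements in these generators to get [E]. Backward, factor in [F] with coefficient matrix [A];
    since [E *m A = A], the [x k] are recombined by [E] from themselves, so the factorization stays
    in [K]. *)
Lemma flat_submodules_split (S : pzRingType) :
  flat_submodules S <-> annihilator_split S.
Proof.
split=> [subS n c r cr|spl F K i iI hF].
  have [J [i [u [iI uE gen]]]] := span_mk ((fun k => r k 0) : 'I_n -> S^o).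
  have hJ : eqflat J := subS _ _ _ iI (@eqflat_regular S).
  have /hJ[L [a [y [xE ca]]]] : \sum_k c 0 k *: u k = 0.
    apply: iI; rewrite linear0 linear_sum.
    transitivity ((c *m r) 0 0); last by rewrite cr mxE.
    by rewrite mxE; apply: eq_bigr => k _; rewrite linearZ uE.
  have [b bE] := choice (fun l => gen (y l)).
  have iy l : i (y l) = \sum_m b l 0 m * r m 0.
    by rewrite bE lincombE /lincomb; under eq_bigr do rewrite uE.
  exists (\matrix_(k, m) \sum_l a k l * b l 0 m).
    apply/matrixP => k z; rewrite ord1 mxE.
    under eq_bigr do rewrite mxE mulr_suml.
    rewrite exchange_big -[in RHS]uE xE linear_sum; apply: eq_bigr => l _ /=.
    rewrite linearZ /= iy [RHS]mulr_sumr.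
    by apply: eq_bigr => m _; rewrite mulrA.
  apply/matrixP => z m; rewrite ord1 !mxE.
  under eq_bigr do rewrite mxE mulr_sumr.
  rewrite exchange_big big1 // => l _ /=.
  under eq_bigr do rewrite mulrA.
  by rewrite -mulr_suml ca mul0r.
apply: eqflat_ord => n c x cx.
have : \sum_k c k *: i (x k) = 0.
  by under eq_bigr do rewrite -linearZ; rewrite -linear_sum cx linear0.
move=> /hF[L [a [y [xE ca]]]].
pose A := \matrix_(k < n, l < #|L|) a k (enum_val l).
have cA : (\row_k c k) *m A = 0.
  apply/rowP => l; rewrite !mxE -[RHS](ca (enum_val l)).
  by apply: eq_bigr => k _; rewrite !mxE.
have [E EA cE] := annihilator_split_cols spl cA.
exists 'I_n, (fun k l => E k l), x; split=> [k|l].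
  apply: iI; rewrite linear_sum xE.
  under [RHS]eq_bigr do rewrite linearZ /= xE sum_enum_val scaler_sumr.
  rewrite exchange_big sum_enum_val; apply: eq_bigr => l _.
  have /matrixP/(_ k l) := EA; rewrite !mxE => <-; rewrite scaler_suml.
  by apply: eq_bigr => j _; rewrite scalerA mxE.
transitivity ((\row_k c k *m E) 0 l); last by rewrite cE mxE.
by rewrite mxE; apply: eq_bigr => k _; rewrite mxE.
Qed.

Lemma relations_fg_converse (R : pzRingType) :
  relations_fg R^c <-> forall n (r : 'cV[R]_n), exists m (K : 'M[R]_(m, n)),
    forall c : 'rV[R]_n, c *m r = 0 <-> exists d : 'rV[R]_m, c = d *m K.
Proof.
have mulE n (c : 'rV[R]_n) (r : 'cV[R]_n) :
    c *m r = 0 <-> \sum_i c 0 i * r i 0 = 0.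
  split=> [/matrixP/(_ 0 0)|cr]; first by rewrite !mxE.
  by apply/matrixP => i j; rewrite !ord1 !mxE.
split=> rel n r.
  have [m [k [rk kP]]] := rel n (fun i => r i 0 : R^c).
  exists m, (\matrix_(j, i) k j i) => c; split=> [/mulE cr|[d ->]].
    have [d dE] := kP (fun i => c 0 i : R^c) cr.
    exists (\row_j d j); apply/rowP => i; rewrite dE mxE.
    by apply: eq_bigr => j _; rewrite !mxE.
  rewrite -mulmxA (_ : _ *m r = 0) ?mulmx0 //.
  apply/matrixP => j z; rewrite ord1 !mxE -[RHS](rk j).
  by apply: eq_bigr => i _; rewrite mxE.
have [m [K KP]] := rel n (\col_i (r i : R)).
exists m, (fun j i => K j i); split=> [j|c rc].
  have /KP/mulE : exists d : 'rV_m, row j K = d *m K.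
    by exists (delta_mx 0 j); rewrite -rowE.
  by under eq_bigr do rewrite !mxE.
have /mulE/KP[d dE] : \sum_i (\row_i (c i : R)) 0 i * (\col_i (r i : R)) i 0 = 0.
  by under eq_bigr do rewrite !mxE; exact: rc.
exists (fun j => d 0 j) => i.
by have /rowP/(_ i) := dE; rewrite !mxE.
Qed.

(** [E] is the matrix of the idempotent that projects the free module onto the ideal spanned by [r]
    and returns by a section. *)
Lemma semihereditary_split (R : pzRingType) n (r : 'cV[R]_n) :
  left_semihereditary R ->
  exists2 E : 'M[R]_n, E *m r = r & forall c : 'rV_n, c *m r = 0 -> c *m E = 0.
Proof.
move=> sh; have [J [i [u [iI uE gen]]]] := span_mk ((fun k => r k 0) : 'I_n -> R^o).
have [p pE] := linear_mk (lincomb_linear u).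
have pS : surjective p by move=> y; have [c ->] := gen y; exists c; rewrite pE.
have [s sE] := sh J i iI (lincomb_fg gen) _ _ p pS idfun.
have ip c : i (p c) = (c *m r) 0 0.
  rewrite pE lincombE lincomb_col !mxE.
  by apply: eq_bigr => k _; rewrite mxE uE.
exists (\matrix_k s (u k)).
  apply/matrixP => k z; rewrite ord1 -uE -[u k in RHS](sE (u k)) ip /=.
  rewrite !mxE; by apply: eq_bigr => l _; rewrite mxE.
move=> c cr; have p0 : p c = 0 by apply: iI; rewrite ip cr mxE linear0.
rewrite mulmx_sum_row -[RHS](linear0 s) -p0 pE linear_sum.
by apply: eq_bigr => k _; rewrite rowK linearZ.
Qed.

(** Forward, the idempotent [E] of [semihereditary_split] kills every relation, so the rows of
    [1%:M - E] generate them. Backward, finitely many rows [K] generate the relations, so a single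
    [E] annihilated by all of them splits the free module onto the ideal. *)
Lemma left_semihereditaryP (R : pzRingType) :
  left_semihereditary R <-> relations_fg R^c /\ flat_submodules R.
Proof.
rewrite relations_fg_converse flat_submodules_split.
split=> [sh|[rel spl] J i iI /fg_lincomb[n [x gen]] A B p pS f].
  split=> [n r|n c r cr]; last first.
    by have [E Er cE] := semihereditary_split r sh; exists E => //; apply: cE.
  have [E Er cE] := semihereditary_split r sh.
  exists n, (1%:M - E) => c; split=> [cr|[d ->]].
    by exists c; rewrite mulmxBr mulmx1 cE // subr0.
  by rewrite -mulmxA mulmxBl mul1mx Er subrr mulmx0.
pose r : 'cV[R]_n := \col_k (i (x k) : R).
have ix c : i (lincomb x c) = (c *m r) 0 0 by rewrite lincombE lincomb_col.
have [m [K KP]] := rel n r.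
have Kr : K *m r = 0.
  apply/row_matrixP => j; rewrite row_mul row0; apply/KP.
  by exists (delta_mx 0 j); rewrite -rowE.
have [E Er KE] := annihilator_split_rows spl Kr.
have xE c : lincomb x (c *m E) = lincomb x c.
  by apply: iI; rewrite !ix -mulmxA Er.
have [a aE] := choice (fun k => pS (f (x k))).
have [g gE] := linear_mk (lincomb_linear x).
have [h hE] := linear_mk (lincomb_linear a).
(* [lincomb x c |-> c *m E] is a well-defined section of [lincomb x]. *)
have wd c d : lincomb x c = lincomb x d -> c *m E = d *m E.
  move=> cd; apply/eqP; rewrite -subr_eq0 -mulmxBl; apply/eqP.
  have /KP[e ->] : (c - d) *m r = 0.
    apply/matrixP => k l; rewrite !ord1 -ix -gE linearB /= !gE cd subrr.
    by rewrite linear0 mxE.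
  by rewrite -mulmxA KE mulmx0.
have [co coE] := choice gen.
have lL : linear (fun y => h (co y *m E)).
  move=> t y z; rewrite -linearP scalemxAl -mulmxDl; congr (h _); apply: wd.
  by rewrite -coE -gE linearP /= !gE -!coE.
have [l lE] := linear_mk lL.
exists l => y; rewrite lE hE lincombE [in RHS](coE y) -xE lincombE.
by apply: eq_bigr => k _; rewrite aE.
Qed.

Theorem proposition3p9 (R : pzRingType) :
  [/\ right_coherent R <->
        (forall M : lmodType R, closed_under_products (left_flat_domain M)),
      wdim_le R 1%N <->
        (forall M : lmodType R, closed_under_submodules (left_flat_domain M))
    & left_semihereditary R <->
        (forall M : lmodType R^c, closed_under_products (right_flat_domain M)) /\
        (forall M : lmodType R, closed_under_submodules (left_flat_domain M))].
Proof.
rewrite /left_flat_domain /right_flat_domain left_flatE right_flatE.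
split.
- by rewrite right_coherentP -flat_products_relations_fg flat_productsP.
- by rewrite wdim_le1P flat_submodulesP.
- rewrite left_semihereditaryP -flat_products_relations_fg flat_productsP.
  by rewrite flat_submodulesP.
Qed.
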